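(* Let $\alpha\in(0,1]$ and $p\in(0,1)$. Let $L(t)=L^{(1)}_{\alpha,1}(t)$ be the single time-fractional queue with parameters $\alpha$, $\lambda=1$, $p$, started empty at time $0$, let $p_{0,0}(t)=\mathbb P\{L(t)=0\}$, and let $M_{\alpha,1}(z,t)=\mathbb E\big(e^{zL(t)}\big)$, $z\in\mathbb R$, $t\ge 0$. Then $M_{\alpha,1}$ satisfies the fractional differential equation $$\frac{d^{\alpha}}{dt^{\alpha}}M_{\alpha,1}(z,t)=(1-p)(1-e^{-z})\,p_{0,0}(t)+\big(pe^{z}-1+(1-p)e^{-z}\big)M_{\alpha,1}(z,t),$$ and its Laplace transform in $t$, $\widetilde M_{\alpha,1}(z,s)=\int_0^\infty e^{-st}M_{\alpha,1}(z,t)\,dt$ (for real $z$ and $s>0$ for which this integral converges), is $$\widetilde M_{\alpha,1}(z,s)=\frac{-s^{\alpha-1}}{p\,(e^{z}-r_1(s))(1-r_2(s))},$$ where $$r_{1}(s)=\frac{1+s^{\alpha}+\sqrt{(1+s^{\alpha})^2-4p(1-p)}}{2p},\qquad r_{2}(s)=\frac{1+s^{\alpha}-\sqrt{(1+s^{\alpha})^2-4p(1-p)}}{2p}.$$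
   Context: Mittag-Leffler function: $E_{a,b}(x)=\sum_{\ell\ge 0}\frac{x^{\ell}}{\Gamma(b+a\ell)}$. For $\alpha\in(0,1]$ and $\lambda>0$, a Mittag-Leffler random variable $X_{\alpha,\lambda}$ with index $\alpha$ and scale $\lambda$ is positive with $\mathbb P\{X_{\alpha,\lambda}>x\}=E_{\alpha,1}(-\lambda^{\alpha}x^{\alpha})$, $x\ge0$. The fractional Poisson process $N^{(\alpha)}_{\lambda}(t)$ is the renewal counting process (with $N^{(\alpha)}_\lambda(0)=0$ and a renewal at time $0$) whose inter-event times are i.i.d. copies of $X_{\alpha,\lambda}$. Discrete queue: $(Q_n)_{n\ge0}$ is the Markov chain on $\{0,1,2,\dots\}$ with transition probabilities $q_{k,k+1}=p$ and $q_{k,k-1}=1-p$ for $k\ge1$, and $q_{0,1}=p$, $q_{0,0}=1-p$. The single time-fractional queue is $L^{(1)}_{\alpha,\lambda}(t)=Q_{N^{(\alpha)}_{\lambda}(t)}$, where $(Q_n)$ is independent of $N^{(\alpha)}_\lambda$; started empty means $Q_0=0$. Caputo derivative (in $t$): for $\alpha\in(0,1)$, $\frac{d^{\alpha}}{dt^{\alpha}}f(t)=\frac{1}{\Gamma(1-\alpha)}\int_0^t(t-u)^{-\alpha}f'(u)\,du$; for $\alpha=1$ it is the ordinary derivative. *)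

(* Defs.v *)
From HB Require Import structures.
From mathcomp Require Import all_boot all_order all_algebra finmap.
From mathcomp Require Import all_classical all_reals all_analysis.

Set Implicit Arguments.
Unset Strict Implicit.
Unset Printing Implicit Defensive.

Import Order.TTheory GRing.Theory Num.Theory.
Import numFieldNormedType.Exports.

Local Open Scope classical_set_scope.
Local Open Scope ring_scope.

(** * Special functions *)

(* Only used at x > 0, where the integral converges. *)
Definition Gamma {R : realType} (x : R) : R :=
  \int[lebesgue_measure]_(u in `]0, +oo[) (u `^ (x - 1) * expR (- u)).

Definition mittag_leffler {R : realType} (a b x : R) : R :=
  limn (series (fun l : nat => x ^+ l / Gamma (b + a * l%:R))).

(** * Caputo derivative and Laplace transform *)

(* [is_caputo_derive alpha f t l]: the Caputo derivative of order alpha of f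
   at t > 0 exists and equals l.  Since [derive1] and the integral are total
   functions, differentiability and integrability are required explicitly. *)
Definition is_caputo_derive {R : realType} (alpha : R) (f : R -> R) (t l : R)
    : Prop :=
  if alpha == 1 then is_derive t (1 : R) f l
  else
    let g := fun u : R => (t - u) `^ (- alpha) * (f^`())%classic u in
    [/\ forall u : R, 0 < u < t -> derivable f u 1,
        lebesgue_measure.-integrable `]0, t[ (EFin \o g) &
        (Gamma (1 - alpha))^-1 * \int[lebesgue_measure]_(u in `]0, t[) g u = l].

Definition laplace_converges {R : realType} (f : R -> R) (s : R) : Prop :=
  lebesgue_measure.-integrable `[0, +oo[
    (EFin \o (fun t : R => expR (- s * t) * f t)).

Definition laplace {R : realType} (f : R -> R) (s : R) : R :=
  \int[lebesgue_measure]_(t in `[0, +oo[) (expR (- s * t) * f t).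

(** * Independence *)

Definition mutually_independent {d d'} {T : measurableType d}
    {U : measurableType d'} {R : realType} (P : probability T R)
    (X : nat -> {RV P >-> U}) : Prop :=
  forall (J : {fset nat}) (B : nat -> set U),
    (forall i, i \in J -> measurable (B i)) ->
    P (\bigcap_(i in [set` J]) (X i @^-1` B i)) =
    (\prod_(i <- J) P (X i @^-1` B i))%E.

Definition sigma_generated {I : Type} {T : Type} {d'} {U : measurableType d'}
    (D : set I) (Y : I -> T -> U) : set (set T) :=
  <<s \bigcup_(i in D) preimage_set_system setT (Y i) measurable >>.

Definition independent_processes {I J : Type} {d d1 d2} {T : measurableType d}
    {U : measurableType d1} {V : measurableType d2} {R : realType}
    (P : probability T R) (D : set I) (Y : I -> T -> U)
    (E : set J) (Z : J -> T -> V) : Prop :=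
  forall A B : set T, sigma_generated D Y A -> sigma_generated E Z B ->
    P (A `&` B) = (P A * P B)%E.

(** * Fractional Poisson process *)

Definition is_mittag_leffler_rv {d} {T : measurableType d} {R : realType}
    (P : probability T R) (alpha lambda : R) (X : {RV P >-> R}) : Prop :=
  {ae P, forall w, 0 < X w} /\
  forall x : R, 0 <= x ->
    P [set w | x < X w] =
    (mittag_leffler alpha 1 (- (lambda `^ alpha * x `^ alpha)))%:E.

(* Number of renewals in ]0, t]; the renewal at time 0 is not counted.
   [X k] is the (k+1)-st inter-event time, so that the (n+1)-st event happens
   at time X 0 + ... + X n.  On outcomes with infinitely many renewals before
   t (a null set in the case of interest), [fset_set] is empty and the count
   is 0. *)
Definition renewal_count {T : Type} {R : realType} (X : nat -> T -> R)
    (t : R) (w : T) : nat :=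
  #|` fset_set [set n : nat | \sum_(k < n.+1) X k w <= t] |.

(** * Discrete queue *)

(* The case j = i.-1 covers both q_{i,i-1} for i >= 1 and q_{0,0}. *)
Definition queue_transition {R : realType} (p : R) (i j : nat) : R :=
  if j == i.+1 then p else if j == i.-1 then 1 - p else 0.

(* Markov property together with homogeneity, with the conditional probability
   multiplied out:
   P(Q_0 = x_0, ..., Q_{n+1} = x_{n+1})
     = P(Q_0 = x_0, ..., Q_n = x_n) q(x_n, x_{n+1}). *)
Definition is_markov_chain {d} {T : measurableType d} {R : realType}
    (P : probability T R) (q : nat -> nat -> R) (Q : nat -> {RV P >-> nat})
    : Prop :=
  forall (n : nat) (x : nat -> nat),
    P [set w | forall k, (k <= n.+1)%N -> Q k w = x k] =
    (P [set w | forall k, (k <= n)%N -> Q k w = x k] *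
     (q (x n) (x n.+1))%:E)%E.

(** * Time-fractional queue *)

(* [X]: inter-event times of the fractional Poisson process; [Q]: discrete
   queue. *)
Definition time_changed {T : Type} {R : realType} (X : nat -> T -> R)
    (Q : nat -> T -> nat) (t : R) (w : T) : nat :=
  Q (renewal_count X t w) w.

Definition is_fractional_queue_data {d} {T : measurableType d} {R : realType}
    (P : probability T R) (alpha lambda p : R)
    (X : nat -> {RV P >-> R}) (Q : nat -> {RV P >-> nat}) : Prop :=
  [/\ mutually_independent X,
      forall k, is_mittag_leffler_rv alpha lambda (X k),
      is_markov_chain (queue_transition p) Q &
      independent_processes P
        [set: nat] (fun n => Q n : T -> nat)
        [set t : R | 0 <= t] (renewal_count (fun k => X k : T -> R))].

Definition started_empty {d} {T : measurableType d} {R : realType}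
    (P : probability T R) (Q : nat -> {RV P >-> nat}) : Prop :=
  {ae P, forall w, Q 0 w = 0%N}.

Definition prob_empty {d} {T : measurableType d} {R : realType}
    (P : probability T R) (L : R -> T -> nat) (t : R) : R :=
  fine (P [set w | L t w = 0%N]).

Definition mgf {d} {T : measurableType d} {R : realType}
    (P : probability T R) (L : R -> T -> nat) (z t : R) : R :=
  fine ('E_P[fun w => expR (z * (L t w)%:R)])%E.

Definition r1 {R : realType} (alpha p s : R) : R :=
  (1 + s `^ alpha
   + Num.sqrt ((1 + s `^ alpha) ^+ 2 - 4 * p * (1 - p))) / (2 * p).

Definition r2 {R : realType} (alpha p s : R) : R :=
  (1 + s `^ alpha
   - Num.sqrt ((1 + s `^ alpha) ^+ 2 - 4 * p * (1 - p))) / (2 * p).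

(* Main.v *)
Require Import Defs.
From HB Require Import structures.
From mathcomp Require Import all_boot all_order all_algebra finmap.
From mathcomp Require Import all_classical all_reals all_analysis.
From mathcomp Require Import measurable_realfun.
From mathcomp Require Import ring lra.

Set Implicit Arguments.
Unset Strict Implicit.
Unset Printing Implicit Defensive.

Import Order.TTheory GRing.Theory Num.Theory.
Import numFieldNormedType.Exports.

(** Write [K_a t = t ^ (a - 1) / Gamma a] for [0 <= t], and 0 for [t < 0]: these
    kernels form a convolution semigroup, [K_a * K_b = K_(a + b)]
    ([convol_rlker]), and [K_alpha] has Laplace transform [s ^ (- alpha)].  All
    functions of time that occur are series
    [G b t = sum_l b_l K_(1 + alpha l) t] with coefficients of at most
    exponential growth ([mlseries]).  On such series convolution with [K_alpha],
    the fractional integral, shifts the coefficients to the right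
    ([convol_mlseries]) and the Caputo derivative shifts them to the left
    ([caputo_mlseries]).

    Let [S_n] be the partial sums of the inter-event times and
    [pi_n t = P(S_n <= t < S_(n+1))], the law of the renewal count.  The
    Mittag-Leffler survival function [F] satisfies [1 - F = K_alpha * F] on the
    half-line, so that conditioning on [S_n] and Tonelli give
    [P(S_(n+1) <= t) = (K_alpha * pi_n) t] ([renewal_equation]), that is
    [pi_(n+1) = K_alpha * pi_n - K_alpha * pi_(n+1)].  This Volterra equation has
    only one bounded solution ([volterra_uniq]), which is the series with
    coefficients [(-1)^(l - n) binomial(l, n)] ([renewal_prob_closed]).  Those
    are the coefficients of Newton's forward difference formula: summing
    against a sequence [f] yields [sum_n f_n pi_n = G (Delta^l f_0)_l]
    ([newton_series]).  Since the queue is independent of the renewals, both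
    [M z] and [p00] are series of this kind, with [f_n] the exponential moment,
    respectively the probability of being empty, of the discrete queue after
    [n] steps ([expectation_mgf], [prob_emptyE]).

    One step of the discrete queue gives [m_(n+1) - m_n = kappa m_n + beta e_n]
    for these two sequences [m] and [e], with [kappa = p e^z - 1 + (1-p) e^(-z)]
    and [beta = (1-p) (1 - e^(-z))].  Taking differences turns it into a
    recursion on the coefficients of [M z], which is the fractional equation
    read coefficientwise ([mgf_coefS], [caputo_mgf]).

    The same recursion in integrated form is
    [M z = 1 + beta (K_alpha * p00) + kappa (K_alpha * M z)], so whenever the
    transform converges [(s ^ alpha - kappa) M~ = s ^ (alpha - 1) + beta p00~].
    The left factor times [e^z] is [- p (e^z - r1) (e^z - r2)].  As
    [0 < r2 < 1 < r1], the transform converges at [e^z = r2], and the vanishing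
    of the factor there determines [p00~] ([laplace_empty], the kernel method).
    Dividing by the factor gives the formula for [e^z <> r2]; at [e^z = r2] it
    follows by squeezing, because [M~] is nondecreasing in [z]
    ([laplace_mgf_at_r2]).  At [e^z = r1] the equation would force
    [s ^ (alpha - 1) = 0], so the transform diverges there. *)

Local Open Scope classical_set_scope.
Local Open Scope ring_scope.

(** * Affine substitution for the Lebesgue integral *)

Lemma ge0_integral_affine (R : realType) (f : R -> \bar R) (c b : R) :
  0 < c -> measurable_fun [set: R] f -> (forall x, (0 <= f x)%E) ->
  (\int[lebesgue_measure]_x f (c * x + b)%R =
   (c^-1)%:E * \int[lebesgue_measure]_x f x)%E.
Proof.
move=> c0 mf f0.
pose phi : measurableTypeR R -> measurableTypeR R := fun x => c * x + b.
have mphi : measurable_fun setT phi.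
  by apply: measurable_funD => //; exact: measurable_funM.
have c0' : 0 <= c by exact: ltW.
(* The image of Lebesgue measure under [phi], rescaled so that it agrees with
   Lebesgue measure on intervals and hence everywhere. *)
pose nu : {measure set (measurableTypeR R) -> \bar R} :=
  mscale (NngNum c0') (pushforward lebesgue_measure phi).
have E A : measurable A -> lebesgue_measure A = nu mphi A.
  apply: lebesgue_measure_unique => {}A [[x y] /= _ <-].
  rewrite /nu /mscale /= /pushforward /=.
  have -> : phi @^-1` `]x, y] = `](x - b) / c, (y - b) / c]%classic.
    apply/seteqP; split => u; rewrite /phi /= !in_itv/=.
    - by move=> /andP[xu uy]; rewrite ltr_pdivrMr// ler_pdivlMr//; lra.
    - by rewrite ltr_pdivrMr// ler_pdivlMr// => /andP[xu uy]; lra.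
  rewrite !lebesgue_measure_itv/= !lte_fin ltr_pM2r ?invr_gt0// ltrD2r.
  case: ifPn => // xy; last by rewrite mule0.
  by rewrite -!EFinD -EFinM; congr (_%:E); field; rewrite gt_eqF.
have -> : (\int[lebesgue_measure]_x f x = c%:E * \int[lebesgue_measure]_x f (phi x))%E.
  rewrite (eq_measure_integral (nu mphi)); last by move=> A mA _; exact: E.
  rewrite ge0_integral_mscale//= ge0_integral_pushforward//.
by rewrite muleA -EFinM mulVf ?gt_eqF// mul1e.
Qed.

Lemma ge0_integral_shift (R : realType) (f : R -> \bar R) (b : R) :
  measurable_fun [set: R] f -> (forall x, (0 <= f x)%E) ->
  (\int[lebesgue_measure]_x f (x - b)%R = \int[lebesgue_measure]_x f x)%E.
Proof.
move=> mf f0; have := ge0_integral_affine (- b) ltr01 mf f0.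
by rewrite invr1 mul1e => <-; apply: eq_integral => x _; rewrite mul1r.
Qed.

(** * The Gamma function *)

Section gamma.
Context {R : realType}.
Local Notation mu := (@lebesgue_measure R).

Lemma measurable_powRexpN (a : R) (D : set R) :
  measurable_fun D (fun u : R => u `^ a * expR (- u)).
Proof.
apply: measurable_funM.
  by apply: measurable_funTS; exact: measurable_powR.
by apply: measurable_funTS; apply: measurableT_comp.
Qed.

(** The fundamental theorem of calculus applies on [1/(n+1), 1] only, the
    integrand being unbounded at 0 for [a < 1]; monotone convergence does the
    rest. *)
Lemma integral_powR01 (a : R) : 0 < a ->
  (\int[mu]_(u in `]0%R, 1%R]) (u `^ (a - 1))%:E = (a^-1)%:E)%E.
Proof.
move=> a0.
pose F (n : nat) : set R := `[n.+1%:R^-1, 1]%classic.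
have UF : `]0%R, 1%R]%classic = \bigcup_n F n.
  apply/seteqP; split=> u; rewrite /F /= ?in_itv/=.
    move=> /andP[u0 u1]; exists (Num.truncn u^-1) => //=.
    rewrite in_itv/= u1 andbT -[leRHS]invrK lef_pV2 ?posrE ?invr_gt0//.
    by apply/ltW/truncnS_gt.
  move=> [n _]; rewrite /= in_itv/= => /andP[nu ->]; rewrite andbT.
  by apply: lt_le_trans nu; rewrite invr_gt0.
have FE n : (\int[mu]_(u in F n) (u `^ (a - 1))%:E =
    (a^-1 - n.+1%:R^-1 `^ a / a)%:E)%E.
  have [n0|n0] := eqVneq n 0%N.
    rewrite n0 /F invr1 set_itv1 integral_set1 powR1 mul1r subrr//.
  have n1 : n.+1%:R^-1 < 1 :> R.
    by rewrite invf_lt1 ?ltr1n ?ltnS ?lt0n.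
  have i0 : 0 < n.+1%:R^-1 :> R by rewrite invr_gt0.
  have dF (x : R) : 0 < x -> is_derive x 1 (fun u : R => u `^ a / a) (x `^ (a - 1)).
    move=> x0; have ? := is_derive1_powR a x0.
    apply: is_derive_eq; rewrite scaler0 add0r /GRing.scale/=.
    by rewrite mulrA mulVf ?mul1r// gt_eqF.
  have cF (x : R) : 0 < x -> {for x, continuous (fun u : R => u `^ a / a)}.
    by move=> x0; apply: differentiable_continuous; apply/derivable1_diffP; apply: (@ex_derive _ _ _ _ _ _ _ (dF _ x0)).
  have cp (x : R) : 0 < x -> {for x, continuous (fun u : R => u `^ (a - 1))}.
    move=> x0; apply: differentiable_continuous; apply/derivable1_diffP.
    by apply: derivable_powR; rewrite in_itv/= x0.
  rewrite (@continuous_FTC2 _ _ (fun u : R => u `^ a / a))//.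
  - by rewrite powR1 mul1r EFinB.
  - apply: continuous_in_subspaceT => x; rewrite inE/= in_itv/= => /andP[x0 _].
    by apply: cp; exact: lt_le_trans x0.
  - split.
    + move=> x; rewrite in_itv/= => /andP[x0 _].
      by apply: (@ex_derive _ _ _ _ _ _ _ (dF _ _)); exact: lt_trans x0.
    + by apply: cvg_at_right_filter; exact: cF.
    + by apply: cvg_at_left_filter; exact: cF.
  - move=> x; rewrite in_itv/= => /andP[x0 _].
    rewrite derive1E; apply: (@derive_val _ _ _ _ _ _ _ (dF _ _)).
    exact: lt_trans x0.
have C1 : (\int[mu]_(u in F n) (u `^ (a - 1))%:E @[n --> \oo] -->
  \int[mu]_(u in `]0%R, 1%R]) (u `^ (a - 1))%:E)%E.
  rewrite UF; apply: ge0_nondecreasing_set_cvg_integral => //.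
  - move=> m n mn; apply/subsetPset => u; rewrite /F /= !in_itv/= => /andP[mu' ->].
    by rewrite andbT (le_trans _ mu')// lef_pV2 ?posrE// ler_nat ltnS.
  - by move=> n; exact: measurable_itv.
  - by move=> n; apply/measurable_EFinP; apply: measurable_funTS; exact: measurable_powR.
  - by move=> n x _; rewrite lee_fin powR_ge0.
have C2 : (\int[mu]_(u in F n) (u `^ (a - 1))%:E @[n --> \oo] --> (a^-1)%:E)%E.
  under eq_fun do rewrite FE.
  apply/fine_cvgP; split; first exact: nearW.
  rewrite -[X in _ --> X]subr0; apply: cvgB; first exact: cvg_cst.
  rewrite -[X in _ --> X](mul0r a^-1); apply: cvgM; last exact: cvg_cst.
  move/cvg_at_rightP: (powR_cvg0 a0); apply; split=> [n|]; first by rewrite invr_gt0.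
  exact: cvg_harmonic.
exact: cvg_unique C1 C2.
Qed.

(** Half of the exponential decay suffices to absorb the power, because
    [(u / 2) ^ n / n!] is one term of the series of [e ^ (u / 2)]; the other half,
    an exponential density up to a factor, makes the bound integrable. *)
Lemma powRexpN_le (a u : R) : 1 < u ->
  u `^ (a - 1) * expR (- u) <=
  2 ^+ (Num.truncn a).+2 * ((Num.truncn a).+1)`!%:R * (2 * exponential_pdf 2^-1 u).
Proof.
move=> u1; set n := (Num.truncn a).+1.
have u0 : 0 <= u by lra.
rewrite exponential_pdfE//.
have -> : 2 * (2^-1 * expR (- 2^-1 * u)) = expR (u / 2) * expR (- u).
  rewrite mulrA mulfV// mul1r -expRD; congr expR; lra.
rewrite mulrA ler_pM2r ?expR_gt0//.
have h1 : u `^ (a - 1) <= u ^+ n.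
  rewrite -powR_mulrn//; apply: ler_powR; first exact: ltW.
  by have := truncnS_gt a; rewrite /n; lra.
apply: (le_trans h1).
have h2 : (u / 2) ^+ n / n`!%:R <= expR (u / 2).
  have := @expR_ge1Dxn R (u / 2) n.-1; rewrite /n/= => /(_ _).
  by move=> H; apply: le_trans (H _); rewrite ?lerDr//; apply: divr_ge0.
move: h2; rewrite ler_pdivrMr ?ltr0n ?fact_gt0// expr_div_n ler_pdivrMr ?exprn_gt0// => h2.
apply: (le_trans h2).
rewrite exprS -!mulrA [leRHS]mulrCA.
have h3 : 0 <= expR (u / 2) * (n`!%:R * 2 ^+ n).
  by apply: mulr_ge0; [exact: expR_ge0|apply: mulr_ge0; [exact: ler0n|exact: exprn_ge0]].
rewrite [leRHS](_ : _ = 2 * (expR (u / 2) * (n`!%:R * 2 ^+ n))); last by rewrite -/n; ring.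
lra.
Qed.

Lemma integrable_Gamma (a : R) : 0 < a ->
  mu.-integrable `]0, +oo[ (EFin \o (fun u => u `^ (a - 1) * expR (- u))).
Proof.
move=> a0.
pose C : R := 2 ^+ (Num.truncn a).+2 * ((Num.truncn a).+1)`!%:R * 2.
have C0 : 0 <= C by apply: mulr_ge0.
pose h u : R := \1_`]0, 1] u * u `^ (a - 1) + C * exponential_pdf 2^-1 u.
apply: (@le_integrable _ _ _ mu _ _ _ (EFin \o h)) => //.
- by apply/measurable_EFinP; exact: measurable_powRexpN.
- move=> u /=; rewrite in_itv/= andbT => u0.
  have pd0 : 0 <= exponential_pdf (2^-1 : R) u by apply: exponential_pdf_ge0.
  have uu : 0 <= u `^ (a - 1) by exact: powR_ge0.
  rewrite lee_fin ger0_norm; last by rewrite mulr_ge0// expR_ge0.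
  rewrite ger0_norm; last first.
    by rewrite /h addr_ge0// mulr_ge0.
  rewrite /h indicE; have [u1|u1] := leP u 1.
    rewrite mem_set/= ?in_itv/= ?u0// mul1r.
    apply: (@le_trans _ _ (u `^ (a - 1))); last by rewrite lerDl mulr_ge0.
    by rewrite ler_piMr// -expR0 ler_expR oppr_le0 ltW.
  rewrite memNset/= ?mul0r ?add0r; last by rewrite in_itv/= u0/= => /(lt_le_trans u1); rewrite ltxx.
  by apply: (le_trans (powRexpN_le a u1)); rewrite /C !mulrA.
- rewrite /h; apply: (@integrableD _ _ _ mu _ _
    (fun u => (\1_`]0, 1] u * u `^ (a - 1))%:E) (fun u => (C * exponential_pdf 2^-1 u)%:E)) => //.
    apply/integrableP; split.
      apply/measurable_EFinP; apply: measurable_funM; first exact: measurable_indic.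
      by apply: measurable_funTS; exact: measurable_powR.
    apply: (@le_lt_trans _ _ (\int[mu]_(u in `]0%R, +oo[) (((fun u : R => (u `^ (a - 1))%:E) \_ `]0%R, 1%R]) u))%E).
      rewrite le_eqVlt; apply/orP; left; apply/eqP; apply: eq_integral => u _.
      rewrite /= patchE indicE; case: ifP => ui; last by rewrite mul0r normr0.
      by rewrite mul1r ger0_norm// powR_ge0.
    rewrite -integral_mkcondr (_ : `]0, +oo[ `&` `]0, 1] = `]0, 1])%classic; last first.
      apply/seteqP; split=> u /=; rewrite !in_itv/= ?andbT; first by case.
      by move=> /andP[-> ->].
    by rewrite integral_powR01// ltry.
  apply: (@eq_integrable _ _ _ mu _ _ (fun u => (C%:E * (exponential_pdf 2^-1 u)%:E)%E)) => //.
  apply: integrableZl => //; apply: (@integrableS _ _ _ mu setT) => //.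
  exact: integrable_exponential_pdf.
Qed.

Lemma EFin_Gamma (a : R) : 0 < a ->
  (Gamma a)%:E = (\int[mu]_(u in `]0%R, +oo[) (u `^ (a - 1) * expR (- u))%:E)%E.
Proof.
move=> a0; rewrite /Gamma /Rintegral fineK//.
by apply: integrable_fin_num => //; exact: integrable_Gamma.
Qed.

(** The integral over [K, K + 1] alone, with the integrand bounded below by
    its values at the ends.  For [K = 1] this is positivity, and for large [K]
    it shows that Gamma outgrows every geometric sequence. *)
Lemma Gamma_ge (a K : R) : 0 < a -> 1 <= K ->
  Num.min (K `^ (a - 1)) ((K + 1) `^ (a - 1)) * expR (- (K + 1)) <= Gamma a.
Proof.
move=> a0 K1; rewrite -lee_fin EFin_Gamma//.
set c := _ * _.
have mf (D : set R) : measurable_fun D (fun u : R => (u `^ (a - 1) * expR (- u))%:E).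
  by apply/measurable_EFinP; exact: measurable_powRexpN.
apply: (@le_trans _ _ (\int[mu]_(u in `[K, (K + 1)%R]) c%:E)%E).
  rewrite integral_cst//= lebesgue_measure_itv/= lte_fin ltrDl ltr01 -EFinD -EFinM lee_fin.
  by rewrite addrAC subrr add0r mulr1.
apply: (@le_trans _ _ (\int[mu]_(u in `[K, (K + 1)%R]) (u `^ (a - 1) * expR (- u))%:E)%E).
  apply: ge0_le_integral => //.
  - by move=> u _; rewrite lee_fin mulr_ge0 ?expR_ge0// le_min !powR_ge0.
  - exact: mf.
  - move=> u /=; rewrite in_itv/= => /andP[Ku uK]; rewrite lee_fin.
    apply: ler_pM; rewrite ?expR_ge0// ?le_min ?powR_ge0//; last by rewrite ler_expR; lra.
    rewrite ge_min; have [a1|a1] := leP 1 a; apply/orP; [left|right].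
      by apply: ge0_ler_powR => //; rewrite ?nnegrE; lra.
    have p1 : 0 < u `^ (1 - a) by apply: powR_gt0; lra.
    have p2 : 0 < (K + 1) `^ (1 - a) by apply: powR_gt0; lra.
    rewrite -(opprB 1 a) !powRN lef_pV2 ?posrE//.
    by apply: ge0_ler_powR => //; rewrite ?nnegrE; lra.
apply: ge0_subset_integral => //.
- exact: mf.
- by move=> u _; rewrite lee_fin mulr_ge0 ?expR_ge0 ?powR_ge0.
- by move=> u /=; rewrite !in_itv/= andbT; lra.
Qed.

Lemma Gamma_gt0 (a : R) : 0 < a -> 0 < Gamma a.
Proof.
move=> a0; apply: lt_le_trans (Gamma_ge a0 (lexx 1)).
by rewrite mulr_gt0 ?expR_gt0// lt_min !powR_gt0.
Qed.
End gamma.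

Local Opaque Gamma.

(** * The Riemann-Liouville kernels *)

Section kernel.
Context {R : realType}.
Local Notation mu := (@lebesgue_measure R).

Lemma integral_half_line (f : R -> \bar R) : measurable_fun [set: R] f ->
  (forall t, t < 0 -> f t = 0%E) ->
  (\int[mu]_t f t = \int[mu]_(t in `]0%R, +oo[) f t)%E.
Proof.
move=> mf f0; rewrite integral_itv_obnd_cbnd; last exact: measurable_funTS.
rewrite [RHS]integral_mkcond; apply: eq_integral => t _.
rewrite patchE; case: ifPn => //; rewrite notin_setE/= in_itv/= andbT.
by move=> /negP; rewrite -ltNge => /f0.
Qed.

(** The Riemann-Liouville kernel of order [a].  Being 0 on the negative axis,
    it turns integrals over [0, t] into convolutions over the whole line.  At 0
    its value is 1 for [a = 1] and 0 otherwise, even if [a < 1]. *)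
Definition rlker (a t : R) : R := if 0 <= t then t `^ (a - 1) / Gamma a else 0.

Lemma rlker_ge0 (a t : R) : 0 < a -> 0 <= rlker a t.
Proof.
by move=> a0; rewrite /rlker; case: ifP => // _; rewrite divr_ge0 ?powR_ge0// ltW ?Gamma_gt0.
Qed.

Lemma rlker_lt0 (a t : R) : t < 0 -> rlker a t = 0.
Proof. by move=> t0; rewrite /rlker leNgt t0. Qed.

Lemma measurable_rlker (a : R) (D : set R) : measurable_fun D (rlker a).
Proof.
apply: measurable_funTS; apply: measurable_fun_ifT => //.
- by apply: measurable_fun_ler.
- by apply: measurable_funM => //; exact: measurable_powR.
Qed.

Lemma rlkerZ (a c t : R) : 0 < c -> rlker a (c * t) = c `^ (a - 1) * rlker a t.
Proof.
move=> c0; rewrite /rlker pmulr_rge0//; case: ifP => t0; last by rewrite mulr0.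
by rewrite powRM ?(ltW c0)// mulrA.
Qed.

Definition laplaceE (s : R) (f : R -> R) : \bar R :=
  (\int[mu]_t (expR (- s * t) * f t)%:E)%E.

Lemma measurable_expM (s : R) : measurable_fun [set: R] (fun t : R => expR (- s * t)).
Proof. by apply: measurableT_comp => //; apply: measurable_funM. Qed.

Lemma laplaceE_rlker (a s : R) : 0 < a -> 0 < s -> laplaceE s (rlker a) = (s `^ (- a))%:E.
Proof.
move=> a0 s0.
pose f (t : R) : \bar R := (expR (- t) * rlker a t)%:E.
have mf : measurable_fun [set: R] f.
  apply/measurable_EFinP; apply: measurable_funM; last exact: measurable_rlker.
  exact: measurableT_comp.
have f0 t : (0 <= f t)%E by rewrite lee_fin mulr_ge0 ?expR_ge0 ?rlker_ge0.
have f1 : (\int[mu]_t f t = 1)%E.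
  rewrite integral_half_line//; last by move=> t t0; rewrite /f rlker_lt0// mulr0.
  transitivity (\int[mu]_(t in `]0%R, +oo[) ((Gamma a)^-1%:E * (t `^ (a - 1) * expR (- t))%:E))%E.
    apply: eq_integral => t; rewrite inE/= in_itv/= andbT => t0.
    by rewrite /f /rlker ltW// -EFinM; congr EFin; ring.
  rewrite ge0_integralZl//.
  - by rewrite -EFin_Gamma// -EFinM mulVf// gt_eqF// Gamma_gt0.
  - by apply/measurable_EFinP; exact: measurable_powRexpN.
  - by move=> t _; rewrite lee_fin mulr_ge0 ?powR_ge0 ?expR_ge0.
  - by rewrite lee_fin invr_ge0 ltW ?Gamma_gt0.
have H := ge0_integral_affine 0 s0 mf f0.
have -> : laplaceE s (rlker a) = ((s `^ (1 - a))%:E * \int[mu]_x f (s * x + 0)%R)%E.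
  rewrite -ge0_integralZl//; last 2 first.
  - by apply: measurableT_comp => //; apply: measurable_funD => //; exact: measurable_funM.
  - by rewrite lee_fin powR_ge0.
  apply: eq_integral => t _; rewrite -EFinM addr0 rlkerZ//; congr EFin.
  have E1 : s `^ (1 - a) * s `^ (a - 1) = 1.
    by rewrite -powRD ?(gt_eqF s0) ?implybT// (_ : _ + _ = 0) ?powRr0//; ring.
  by rewrite mulNr -[LHS]mul1r -[X in X * _ = _]E1 /f; ring.
rewrite H f1 mule1 -EFinM; congr EFin.
rewrite -[X in _ * X]powR_inv1 ?(ltW s0)// -powRD; last by rewrite (gt_eqF s0) implybT.
by congr (_ `^ _); ring.
Qed.

Definition convol (f g : R -> R) (t : R) : \bar R := (\int[mu]_u (f (t - u) * g u)%:E)%E.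

(** Tonelli and translation invariance; nonnegativity makes the identity hold
    in the extended reals without integrability conditions. *)
Lemma laplace_convol (s : R) (f g : R -> R) :
  measurable_fun [set: R] f -> measurable_fun [set: R] g ->
  (forall t, 0 <= f t) -> (forall t, 0 <= g t) ->
  (\int[mu]_t ((expR (- s * t))%:E * convol f g t) = laplaceE s f * laplaceE s g)%E.
Proof.
move=> mf mg f0 g0.
pose F (z : R * R) : \bar R := (expR (- s * z.1) * (f (z.1 - z.2) * g z.2))%:E.
have mF : measurable_fun [set: R * R] F.
  apply/measurable_EFinP; apply: measurable_funM.
    by apply: measurableT_comp => //; apply: measurable_funM.
  apply: measurable_funM; last exact: measurableT_comp.
  by apply: measurableT_comp => //; exact: measurable_funB.
have F0 z : (0 <= F z)%E by rewrite lee_fin !mulr_ge0 ?expR_ge0.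
have mfg t : measurable_fun [set: R] (fun u => (f (t - u) * g u)%:E).
  apply/measurable_EFinP; apply: measurable_funM => //.
  by apply: measurableT_comp => //; exact: measurable_funB.
transitivity (\int[mu]_t \int[mu]_u F (t, u))%E.
  apply: eq_integral => t _; rewrite /convol -ge0_integralZl//; first exact: mfg.
  by move=> u _; rewrite lee_fin mulr_ge0.
rewrite (fubini_tonelli (m1 := mu) (m2 := mu) F mF F0).
have mh : measurable_fun [set: R] (fun x : R => (expR (- s * x) * f x)%:E).
  by apply/measurable_EFinP; apply: measurable_funM => //; exact: measurable_expM.
transitivity (\int[mu]_u (laplaceE s f * (expR (- s * u) * g u)%:E))%E.
  apply: eq_integral => u _.
  rewrite /laplaceE muleC -(@ge0_integral_shift _ (fun x => (expR (- s * x) * f x)%:E) u)//; last first.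
    by move=> x; rewrite lee_fin mulr_ge0 ?expR_ge0.
  rewrite -ge0_integralZl//.
  - apply: eq_integral => t _; rewrite /F/= -EFinM; congr EFin.
    rewrite (_ : - s * t = - s * u + - s * (t - u)); last by ring.
    by rewrite expRD; ring.
  - apply/measurable_EFinP; apply: measurable_funM.
      by apply: measurableT_comp => //; apply: measurable_funM => //; exact: measurable_funB.
    by apply: measurableT_comp => //; exact: measurable_funB.
  - by move=> x _; rewrite lee_fin mulr_ge0 ?expR_ge0.
  - by rewrite lee_fin mulr_ge0 ?expR_ge0.
rewrite ge0_integralZl//.
- by apply/measurable_EFinP; apply: measurable_funM => //; exact: measurable_expM.
- by move=> x _; rewrite lee_fin mulr_ge0 ?expR_ge0.
- by apply: integral_ge0 => x _; rewrite lee_fin mulr_ge0 ?expR_ge0.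
Qed.

Lemma measurable_convol (f g : R -> R) :
  measurable_fun [set: R] f -> measurable_fun [set: R] g ->
  (forall t, 0 <= f t) -> (forall t, 0 <= g t) ->
  measurable_fun [set: R] (convol f g).
Proof.
move=> mf mg f0 g0.
apply: (measurable_fun_fubini_tonelli_F (m2 := mu)
  (fun z : R * R => (f (z.1 - z.2) * g z.2)%:E)).
  apply/measurable_EFinP; apply: measurable_funM; last exact: measurableT_comp.
  by apply: measurableT_comp => //; exact: measurable_funB.
by move=> z; rewrite lee_fin mulr_ge0.
Qed.

(** Homogeneity, by the substitution [u = t x]: only the value at 1, a Beta
    integral up to a factor, remains to be found. *)
Lemma convol_rlker_scale (a b t : R) : 0 < a -> 0 < b -> 0 < t ->
  convol (rlker a) (rlker b) t = ((t `^ (a + b - 1))%:E * convol (rlker a) (rlker b) 1)%E.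
Proof.
move=> a0 b0 t0.
have mfg x : measurable_fun [set: R] (fun u => (rlker a (x - u) * rlker b u)%:E).
  apply/measurable_EFinP; apply: measurable_funM; last exact: measurable_rlker.
  by apply: measurableT_comp; [exact: measurable_rlker|exact: measurable_funB].
have fg0 x u : (0 <= (rlker a (x - u) * rlker b u)%:E)%E by rewrite lee_fin mulr_ge0 ?rlker_ge0.
have H := ge0_integral_affine 0 t0 (mfg t) (fg0 t).
transitivity (t%:E * (\int[mu]_x (rlker a (t - (t * x + 0)) * rlker b (t * x + 0)%R)%:E))%E.
  by rewrite H muleA -EFinM mulfV ?gt_eqF// mul1e.
transitivity (\int[mu]_x (t%:E * (rlker a (t - (t * x + 0)) * rlker b (t * x + 0)%R)%:E))%E.
  apply/esym/ge0_integralZl => //; last exact/ltW/t0.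
  apply/measurable_EFinP; apply: measurable_funM.
    apply: measurableT_comp; [exact: measurable_rlker|apply: measurable_funB => //].
    by apply: measurable_funD => //; exact: measurable_funM.
  apply: measurableT_comp; first exact: measurable_rlker.
  by apply: measurable_funD => //; exact: measurable_funM.
transitivity (\int[mu]_x ((t `^ (a + b - 1))%:E * (rlker a (1 - x) * rlker b x)%:E))%E; last first.
  by apply: ge0_integralZl => //; [exact: mfg|rewrite lee_fin powR_ge0].
apply: eq_integral => u _; rewrite -!EFinM; congr EFin.
rewrite addr0 (_ : t - t * u = t * (1 - u)); last by ring.
rewrite !rlkerZ// (_ : a + b - 1 = (a - 1) + (b - 1) + 1); last by ring.
have tn (x : bool) : x ==> (t != 0) by rewrite (gt_eqF t0) implybT.
rewrite (@powRD _ t (a - 1 + (b - 1)) 1 (tn _)) (@powRD _ t (a - 1) (b - 1) (tn _)).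
by rewrite (powRr1 (ltW t0)); ring.
Qed.

Lemma convol_le0 (a t : R) (f : R -> R) : (forall u, u < 0 -> f u = 0) -> t <= 0 ->
  convol (rlker a) f t = 0%E.
Proof.
move=> f0 t0.
rewrite /convol -(@integral_set1 R (fun u => (rlker a (t - u) * f u)%:E) 0).
rewrite [RHS]integral_mkcond; apply: eq_integral => u _.
rewrite patchE; case: ifPn => //; rewrite notin_setE/= => /eqP.
rewrite neq_lt => /orP[u0|u0]; first by rewrite f0// mulr0.
by rewrite (@rlker_lt0 _ (t - u)) ?mul0r//; lra.
Qed.

(** The Beta integral in disguise.  By [convol_rlker_scale] the convolution is
    a multiple of [rlker (a + b)], and comparing Laplace transforms at [s = 1]
    shows that the multiple is 1.  At [t = 0] the convolution vanishes whereas
    the kernel of order 1 equals 1, hence the side condition. *)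
Lemma convol_rlker (a b t : R) : 0 < a -> 0 < b -> (t != 0) || (a + b != 1) ->
  convol (rlker a) (rlker b) t = (rlker (a + b) t)%:E.
Proof.
move=> a0 b0 tab.
have ab0 : 0 < a + b by exact: addr_gt0.
set B := convol (rlker a) (rlker b) 1.
have B0 : (0 <= B)%E by apply: integral_ge0 => u _; rewrite lee_fin mulr_ge0 ?rlker_ge0.
have G0 := Gamma_gt0 ab0.
have HB : ((Gamma (a + b))%:E * B = 1)%E.
  have := laplace_convol 1 (@measurable_rlker a [set: R]) (@measurable_rlker b [set: R])
    (fun t => rlker_ge0 t a0) (fun t => rlker_ge0 t b0).
  rewrite (laplaceE_rlker a0 ltr01) (laplaceE_rlker b0 ltr01) !powR1 mule1 => <-.
  have mc : measurable_fun [set: R] (convol (rlker a) (rlker b)).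
    by apply: measurable_convol => //; try exact: measurable_rlker; move=> u; exact: rlker_ge0.
  rewrite integral_half_line; last 2 first.
  - by apply: emeasurable_funM => //; apply/measurable_EFinP; exact: measurable_expM.
  - move=> t' t0; rewrite convol_le0 ?mule0 ?(ltW t0)//.
    by move=> u; exact: rlker_lt0.
  rewrite EFin_Gamma// muleC -ge0_integralZl//; first last.
  - by move=> u _; rewrite lee_fin mulr_ge0 ?powR_ge0 ?expR_ge0.
  - by apply/measurable_EFinP; exact: measurable_powRexpN.
  apply: eq_integral => u; rewrite inE/= in_itv/= andbT => u0.
  by rewrite convol_rlker_scale// -/B mulN1r muleA -EFinM muleC mulrC.
have BE : B = ((Gamma (a + b))^-1)%:E.
  by rewrite -[B]mul1e -[1%E](_ : ((Gamma (a + b))^-1)%:E * (Gamma (a + b))%:E = 1)%E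
    -?muleA ?HB ?mule1// -EFinM mulVf// gt_eqF.
have [t0|t0|t0] := ltgtP t 0.
- by rewrite convol_le0 ?(ltW t0) ?rlker_lt0// => u; exact: rlker_lt0.
- by rewrite convol_rlker_scale// -/B BE -EFinM /rlker ltW.
- move: tab; rewrite t0 eqxx/= => ab1; rewrite convol_le0// => [|u]; last exact: rlker_lt0.
  rewrite /rlker lexx powR0 ?mul0r//.
  by rewrite subr_eq0.
Qed.

Lemma Gamma1 : Gamma 1 = 1 :> R.
Proof.
apply: EFin_inj; rewrite EFin_Gamma//.
rewrite -(@integral_exponential_pdf R 1)// [RHS]integral_half_line; last 2 first.
- by apply/measurable_EFinP; exact: measurable_exponential_pdf.
- by move=> t t0; rewrite lt0_exponential_pdf.
apply: eq_integral => t; rewrite inE/= in_itv/= andbT => t0.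
by rewrite exponential_pdfE ?ltW// subrr powRr0 mulN1r.
Qed.

Lemma rlker1 (t : R) : rlker 1 t = (0 <= t)%R%:R.
Proof. by rewrite /rlker subrr powRr0 Gamma1 divr1; case: ifP. Qed.

(** The semigroup law for the orders 1 and [a], evaluated at 1. *)
Lemma GammaS (a : R) : 0 < a -> Gamma (a + 1) = a * Gamma a.
Proof.
move=> a0; have a10 : 0 < a + 1 by lra.
have := @convol_rlker 1 a 1 ltr01 a0; rewrite oner_neq0 addrC => /(_ isT).
rewrite /convol integral_half_line; last 2 first.
- apply/measurable_EFinP; apply: measurable_funM; last exact: measurable_rlker.
  by apply: measurableT_comp; [exact: measurable_rlker|exact: measurable_funB].
- by move=> t t0; rewrite (rlker_lt0 a)// mulr0.
have -> : (\int[mu]_(t in `]0%R, +oo[) (rlker 1 (1 - t) * rlker a t)%:E =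
   \int[mu]_(t in `]0%R, 1%R]) ((Gamma a)^-1%:E * (t `^ (a - 1))%:E))%E.
  rewrite [LHS]integral_mkcond [RHS]integral_mkcond; apply: eq_integral => t _.
  rewrite !patchE; have [t0|t0] := ltP 0 t; last first.
    by rewrite memNset ?memNset//= in_itv/= ltNge t0.
  rewrite mem_set/= ?in_itv/= ?t0// rlker1 subr_ge0; case: ifPn.
    by rewrite inE/= in_itv/= => /andP[_ ->]; rewrite mul1r /rlker (ltW t0) mulrC.
  by rewrite notin_setE/= in_itv/= t0/= => /negP/negbTE ->; rewrite mul0r.
rewrite ge0_integralZl//.
- rewrite integral_powR01// -EFinM => H. move: H => /(congr1 fine)/=.
  rewrite /rlker ler01 powR1 div1r => /(congr1 GRing.inv).
  by rewrite invrK invfM !invrK mulrC.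
- by apply/measurable_EFinP; apply: measurable_funTS; exact: measurable_powR.
- by move=> t _; rewrite lee_fin powR_ge0.
- by rewrite lee_fin invr_ge0 ltW// Gamma_gt0.
Qed.

(** [Gamma_ge] with [K] so large that [K ^ alpha >= 2 C]. *)
Lemma Gamma_growth (alpha C : R) : 0 < alpha -> 0 <= C ->
  exists2 B, 0 <= B & forall l, C ^+ l / Gamma (1 + alpha * l%:R) <= B * 2^-1 ^+ l.
Proof.
move=> ml_index_gt0 C0.
pose K : R := Num.max 1 ((2 * C) `^ alpha^-1).
have K1 : 1 <= K by rewrite le_max lexx.
have KC : 2 * C <= K `^ alpha.
  have -> : 2 * C = ((2 * C) `^ alpha^-1) `^ alpha.
    by rewrite -powRrM mulVf ?gt_eqF// powRr1//; lra.
  apply: ge0_ler_powR; rewrite ?nnegrE ?powR_ge0 ?(ltW ml_index_gt0)//; first by lra.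
  by rewrite le_max lexx orbT.
exists (expR (K + 1)); first exact: expR_ge0.
move=> l; have al : 0 <= alpha * l%:R by rewrite mulr_ge0// ltW.
have g0 : 0 < 1 + alpha * l%:R by lra.
rewrite ler_pdivrMr ?Gamma_gt0//.
apply: (@le_trans _ _ (expR (K + 1) * 2^-1 ^+ l * ((K `^ alpha) ^+ l * expR (- (K + 1))))); last first.
  apply: ler_wpM2l; first by rewrite mulr_ge0 ?expR_ge0// exprn_ge0// invr_ge0.
  apply: le_trans (Gamma_ge g0 K1); rewrite ler_pM2r ?expR_gt0//.
  rewrite (_ : 1 + alpha * l%:R - 1 = alpha * l%:R); last by ring.
  rewrite -powR_mulrn ?powR_ge0// -powRrM le_min lexx/=.
  by apply: ge0_ler_powR; rewrite ?nnegrE//; lra.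
rewrite [leRHS](_ : _ = (2^-1 * K `^ alpha) ^+ l); last first.
  rewrite exprMn expRN; field; by rewrite gt_eqF ?expR_gt0.
by apply: lerXn2r; rewrite ?nnegrE//; lra.
Qed.
End kernel.

(** * Series of Mittag-Leffler type *)

Lemma is_cvg_geometric_half (R : realType) (B : R) : cvgn (series (geometric B 2^-1)).
Proof. by apply: is_cvg_geometric_series; rewrite ger0_norm ?invr_ge0// invf_lt1 ?ltr1n. Qed.

Lemma geometric_half_lt (R : realType) (B e : R) : 0 < e ->
  exists N, forall n, (N <= n)%N -> B * 2^-1 ^+ n < e.
Proof.
move=> e0.
have h : `|2^-1 : R| < 1 by rewrite ger0_norm ?invr_ge0// invf_lt1 ?ltr1n.
have /cvgr0Pnorm_lt /(_ e e0) [N _ HN] := cvg_geometric B h.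
exists N => n Nn; exact: le_lt_trans (ler_norm _) (HN n Nn).
Qed.

Section mlseries.
Context {R : realType}.
Local Notation mu := (@lebesgue_measure R).
Variable alpha : R.
Hypothesis alpha0 : 0 < alpha.

(** The monomials [t ^ (alpha l) / Gamma (1 + alpha l)] of the Mittag-Leffler
    series, extended by 0 to negative times. *)
Definition mlmon (l : nat) : R -> R := rlker (1 + alpha * l%:R).

Lemma ml_index_gt0 l : 0 < 1 + alpha * l%:R.
Proof. by rewrite ltr_pwDl// mulr_ge0// ltW. Qed.
Hint Resolve ml_index_gt0 : core.

Lemma mlmon_ge0 l t : 0 <= mlmon l t.
Proof. exact: rlker_ge0. Qed.
Hint Resolve mlmon_ge0 : core.

Lemma mlmonE l t : 0 <= t -> mlmon l t = (t `^ alpha) ^+ l / Gamma (1 + alpha * l%:R).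
Proof.
move=> t0; rewrite /mlmon /rlker t0 -powR_mulrn ?powR_ge0// -powRrM.
by congr (_ `^ _ / _); ring.
Qed.

Lemma mlmon_le l u t : u <= t -> mlmon l u <= mlmon l t.
Proof.
move=> ut; have [u0|u0] := ltP u 0; first by rewrite /mlmon rlker_lt0// rlker_ge0.
rewrite !mlmonE ?(le_trans u0 ut)//.
rewrite ler_pM2r ?invr_gt0 ?Gamma_gt0//.
by apply: lerXn2r; rewrite ?nnegrE ?powR_ge0// ge0_ler_powR ?nnegrE ?(ltW alpha0)// (le_trans u0).
Qed.

Lemma mlmon_growth C t : 0 <= C ->
  exists2 B, 0 <= B & forall l, C ^+ l * mlmon l t <= B * 2^-1 ^+ l.
Proof.
move=> C0; have [t0|t0] := ltP t 0.
  by exists 0 => // l; rewrite /mlmon rlker_lt0// mulr0 mul0r.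
have [|B B0 HB] := @Gamma_growth R alpha (C * t `^ alpha) alpha0.
  by rewrite mulr_ge0 ?powR_ge0.
by exists B => // l; rewrite mlmonE// mulrA -exprMn.
Qed.

Lemma is_cvg_mlmon C t : 0 <= C -> cvgn (series (fun l => C ^+ l * mlmon l t)).
Proof.
move=> C0; have [B B0 HB] := mlmon_growth t C0.
apply: (@series_le_cvg _ _ (geometric B 2^-1)) => [l|l|//|].
- by rewrite mulr_ge0 ?exprn_ge0.
- by rewrite mulr_ge0 ?exprn_ge0// invr_ge0.
- exact: is_cvg_geometric_half.
Qed.

(** The growth condition under which [mlseries] converges absolutely at every
    time. *)
Definition expbounded (b : nat -> R) :=
  exists A C : R, [/\ 0 <= A, 0 <= C & forall l, `|b l| <= A * C ^+ l].

Lemma expboundedZ k b : expbounded b -> expbounded (fun l => k * b l).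
Proof.
move=> [A [C [A0 C0 bC]]]; exists (`|k| * A), C; split => //; first by rewrite mulr_ge0.
by move=> l; rewrite normrM -mulrA ler_wpM2l.
Qed.

Lemma expboundedD b c : expbounded b -> expbounded c -> expbounded (fun l => b l + c l).
Proof.
move=> [A [C [A0 C0 bC]]] [A' [C' [A'0 C'0 cC]]]; exists (A + A'), (C + C').
split; [exact: addr_ge0|exact: addr_ge0|] => l.
apply: (le_trans (ler_normD _ _)); rewrite mulrDl lerD//.
  apply: (le_trans (bC l)); rewrite ler_wpM2l//.
  by apply: lerXn2r; rewrite ?nnegrE ?addr_ge0// lerDl.
apply: (le_trans (cC l)); rewrite ler_wpM2l//.
by apply: lerXn2r; rewrite ?nnegrE ?addr_ge0// lerDr.
Qed.

Lemma expbounded_exp C : 0 <= C -> expbounded (fun l => C ^+ l).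
Proof. by move=> C0; exists 1, C; split => // l; rewrite mul1r ger0_norm ?exprn_ge0. Qed.

Definition mlseries (b : nat -> R) (t : R) : R := limn (series (fun l => b l * mlmon l t)).

Lemma is_cvg_mlseries_norm b t : expbounded b ->
  cvgn (series (fun l => `|b l * mlmon l t|)).
Proof.
move=> [A [C [A0 C0 bC]]].
apply: (@series_le_cvg _ _ (fun l => A * (C ^+ l * mlmon l t))) => [l|l|l|] //.
- by rewrite !mulr_ge0 ?exprn_ge0.
- by rewrite normrM (ger0_norm (mlmon_ge0 _ _)) mulrA ler_wpM2r.
- have -> : (fun l => A * (C ^+ l * mlmon l t)) = A *: (fun l => C ^+ l * mlmon l t) by apply/funext.
  exact/is_cvg_seriesZ/is_cvg_mlmon.
Qed.

Lemma is_cvg_mlseries b t : expbounded b -> cvgn (series (fun l => b l * mlmon l t)).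
Proof. by move=> hb; apply: normed_cvg; exact: is_cvg_mlseries_norm. Qed.

Lemma norm_mlseries b t : expbounded b ->
  `|mlseries b t| <= limn (series (fun l => `|b l * mlmon l t|)).
Proof.
by move=> hb; apply: (@lim_series_norm R R^o (fun l => b l * mlmon l t)); exact: is_cvg_mlseries_norm.
Qed.

Lemma cvg_mlseries b t : expbounded b ->
  series (fun l => b l * mlmon l t) @ \oo --> mlseries b t.
Proof. exact: is_cvg_mlseries. Qed.

Lemma mlseriesD b c t : expbounded b -> expbounded c ->
  mlseries (fun l => b l + c l) t = mlseries b t + mlseries c t.
Proof.
move=> hb hc; rewrite /mlseries -lim_seriesD; try exact: is_cvg_mlseries.
by congr (limn (series _)); apply/funext => l; rewrite mulrDl.
Qed.

Lemma mlseriesZ k b t : expbounded b -> mlseries (fun l => k * b l) t = k * mlseries b t.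
Proof.
move=> hb; rewrite /mlseries.
have -> : (fun l => k * b l * mlmon l t) = k *: (fun l => b l * mlmon l t).
  by apply/funext => l; rewrite -mulrA.
exact/lim_seriesZ/is_cvg_mlseries.
Qed.

(** If the first [n] coefficients vanish, then [1 <= D ^ (l - n)] on the
    others, at the price of replacing [C] by [C * D].  Thus the tails of these
    series are smaller than any geometric sequence. *)
Lemma mlseries_tail (A C D : R) n b t : 0 <= A -> 0 <= C -> 1 <= D ->
  (forall l, `|b l| <= A * C ^+ l) -> (forall l, (l < n)%N -> b l = 0) ->
  `|mlseries b t| <= A * mlseries (fun l => (C * D) ^+ l) t / D ^+ n.
Proof.
move=> A0 C0 D1 bC b0; have D0 : 0 <= D by lra.
have hb : expbounded b by exists A, C.
have CD0 : 0 <= C * D by rewrite mulr_ge0.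
apply: (le_trans (norm_mlseries t hb)).
have hCD := expbounded_exp CD0.
have hE := expboundedZ (A / D ^+ n) hCD.
rewrite mulrAC -mlseriesZ//.
apply: lim_series_le => [|//|l].
- exact: is_cvg_mlseries_norm.
- exact: is_cvg_mlseries.
- rewrite normrM (ger0_norm (mlmon_ge0 _ _)) ler_wpM2r//.
  have [ln|nl] := ltnP l n.
    by rewrite b0// normr0 mulr_ge0 ?exprn_ge0// divr_ge0 ?exprn_ge0.
  apply: le_trans (bC l) _; rewrite -mulrA ler_wpM2l//.
  have Dn : 0 < D ^+ n by apply: exprn_gt0; lra.
  rewrite exprMn mulrCA; apply: ler_peMr; first exact: exprn_ge0.
  by rewrite mulrC ler_pdivlMr// mul1r; apply: ler_weXn2l.
Qed.

Lemma measurable_mlseries b : expbounded b -> measurable_fun [set: R] (mlseries b).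
Proof.
move=> hb.
apply: (@measurable_fun_cvg _ _ _ _ (fun n t => series (fun l => b l * mlmon l t) n)) => [n|t _].
  rewrite /series/=; apply: measurable_sum => l.
  by apply: measurable_funM => //; exact: measurable_rlker.
exact: cvg_mlseries.
Qed.

Lemma mlseries_lt0 b t : t < 0 -> mlseries b t = 0.
Proof.
move=> t0; apply: cvg_lim => //.
rewrite (_ : series _ = cst 0); first exact: cvg_cst.
apply/funext => n; rewrite /series/= big1// => l _.
by rewrite /mlmon rlker_lt0// mulr0.
Qed.

Lemma mlseries_bound (A C : R) b u t : 0 <= A -> 0 <= C -> (forall l, `|b l| <= A * C ^+ l) ->
  u <= t -> `|mlseries b u| <= A * mlseries (fun l => C ^+ l) t.
Proof.
move=> A0 C0 bC ut.
have hb : expbounded b by exists A, C.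
apply: (le_trans (norm_mlseries u hb)).
have hC := expbounded_exp C0.
rewrite -mlseriesZ//.
apply: lim_series_le => [|//|l].
- exact: is_cvg_mlseries_norm.
- by apply: is_cvg_mlseries; exact: expboundedZ.
- rewrite normrM (ger0_norm (mlmon_ge0 _ _)); apply: ler_pM => //.
  exact: mlmon_le.
Qed.

End mlseries.

(** * Fractional integration and Volterra equations *)

Section fracint.
Context {R : realType}.
Local Notation mu := (@lebesgue_measure R).

Lemma integrable_mull d (T : measurableType d) (nu : {measure set T -> \bar R})
    (D : set T) (f : T -> R) (k : R) :
  measurable D -> nu.-integrable D (EFin \o f) ->
  nu.-integrable D (EFin \o (fun x => k * f x)).
Proof.
move=> mD intf; apply: (@eq_integrable _ _ _ nu _ mD (fun x => (k%:E * (EFin \o f) x)%E)).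
  by move=> x _; rewrite /= EFinM.
exact: integrableZl.
Qed.

Lemma integrable_addr d (T : measurableType d) (nu : {measure set T -> \bar R})
    (D : set T) (f g : T -> R) :
  measurable D -> nu.-integrable D (EFin \o f) -> nu.-integrable D (EFin \o g) ->
  nu.-integrable D (EFin \o (fun x => f x + g x)).
Proof.
move=> mD intf intg.
apply: (@eq_integrable _ _ _ nu _ mD ((EFin \o f) \+ (EFin \o g))%E).
  by move=> x _; rewrite /= EFinD.
exact: integrableD.
Qed.

(** Dominated convergence, in the form needed to integrate a series against a
    weight that may be singular at the ends of the domain. *)
Lemma integral_weighted_series (D : set R) (w : R -> R) (g : nat -> R -> R) (A : nat -> R) :
  measurable D -> mu.-integrable D (EFin \o w) ->
  (forall l, measurable_fun D (g l)) ->
  (forall l u, D u -> `|g l u| <= A l) -> cvgn (series A) ->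
  mu.-integrable D (EFin \o (fun u => w u * limn (series (fun l => g l u)))) /\
  series (fun l => \int[mu]_(u in D) (w u * g l u)) @ \oo -->
    \int[mu]_(u in D) (w u * limn (series (fun l => g l u))).
Proof.
move=> mD iw mg gA cA.
have cg u : D u -> cvgn (series (fun l => g l u)).
  move=> Du; apply: normed_cvg.
  apply: (@series_le_cvg _ _ A) => [l|l|l|//].
  - exact: normr_ge0.
  - exact: (le_trans (normr_ge0 _) (gA l u Du)).
  - exact: gA.
have mw : measurable_fun D w by apply/measurable_EFinP; exact: measurable_int iw.
have iwg l : mu.-integrable D (EFin \o (fun u => w u * g l u)).
  apply: (@le_integrable _ _ _ mu _ mD _ (EFin \o (fun u => A l * w u))).
  - by apply/measurable_EFinP; exact: (measurable_funM mw (mg l)).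
  - move=> u Du /=; rewrite lee_fin !normrM mulrC ler_wpM2r//.
    by apply: (le_trans (gA l u Du)); exact: ler_norm.
  - exact: integrable_mull.
have iS n : mu.-integrable D (EFin \o (fun u => w u * series (fun l => g l u) n)) /\
    \int[mu]_(u in D) (w u * series (fun l => g l u) n) =
    series (fun l => \int[mu]_(u in D) (w u * g l u)) n.
  elim: n => [|n [IH1 IH2]].
    rewrite /series/= big_geq//.
    have E0 : (fun u : R => w u * \sum_(0 <= l < 0) g l u) = cst 0.
      by apply/funext => u; rewrite big_geq// mulr0.
    rewrite E0; split; first exact: integrable0.
    by rewrite /Rintegral integral0.
  have ES : (fun u : R => w u * series (fun l => g l u) n.+1) =
      (fun u => w u * series (fun l => g l u) n + w u * g n u).
    by apply/funext => u; rewrite seriesSr mulrDr.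
  rewrite ES; split.
    exact: integrable_addr.
  by rewrite RintegralD// IH2 seriesSr.
have [| | | | |H1 _ H2] := @dominated_convergence _ _ _ mu D mD
  (fun n u => (w u * series (fun l => g l u) n)%:E)
  (fun u => (w u * limn (series (fun l => g l u)))%:E)
  (fun u => ((limn (series A))%:E * `|(w u)%:E|)%E).
- by move=> n; exact: measurable_int (iS n).1.
- apply/measurable_EFinP; apply: measurable_funM => //.
  apply: (@measurable_fun_cvg _ _ _ _ (fun n u => series (fun l => g l u) n)) => [n|u Du].
    by rewrite /series/=; apply: measurable_sum => l.
  exact: cg.
- by apply: aeW => u Du; apply: cvg_EFin; [exact: nearW|apply: cvgMl_tmp; exact: cg].
- by apply: integrableZl => //; exact: integrable_abse.
- apply: aeW => u n Du; rewrite /= lee_fin normrM mulrC ler_wpM2r//.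
  apply: (le_trans (ler_norm_sum _ _ _)).
  apply: (@le_trans _ _ (series A n)); first by apply: ler_sum => l _; exact: gA.
  apply: nondecreasing_cvgn_le => //.
  apply: nondecreasing_series => l _ _; apply: le_trans (gA l u Du) => //.
split=> //.
have H3 : (\int[mu]_(u in D) (w u * series (fun l => g l u) n)%:E)%E @[n --> \oo] -->
    (\int[mu]_(u in D) (w u * limn (series (fun l => g l u))))%:E.
  by rewrite /Rintegral fineK; [exact: H2|exact: integrable_fin_num].
move/fine_cvg : H3; apply: cvg_trans; apply: near_eq_cvg; apply: nearW => n /=.
by rewrite -(iS n).2.
Qed.

Lemma convol_itv (a : R) (f : R -> R) (t : R) : measurable_fun [set: R] f ->
  (forall u, u < 0 -> f u = 0) -> 0 < t ->
  (convol (rlker a) f t = \int[mu]_(u in `]0%R, t[) (rlker a (t - u) * f u)%:E)%E.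
Proof.
move=> mf f0 t0.
rewrite -(@integral_itv_bndoo _ _ _ _ true false); last first.
  apply/measurable_EFinP; apply: measurable_funM; last exact: measurable_funTS.
  apply: measurableT_comp; first exact: measurable_rlker.
  exact: measurable_funB.
rewrite [RHS]integral_mkcond; apply: eq_integral => u _.
rewrite patchE; case: ifPn => //; rewrite notin_setE/= in_itv/= => /negP.
rewrite negb_and -!ltNge => /orP[u0|tu]; first by rewrite f0// mulr0.
by rewrite rlker_lt0 ?mul0r//; lra.
Qed.

Lemma integral_rlkerM (a b t : R) : 0 < a -> 0 < b -> 0 < t ->
  (\int[mu]_(u in `]0%R, t[) (rlker a (t - u) * rlker b u)%:E = (rlker (a + b) t)%:E)%E.
Proof.
move=> a0 b0 t0; rewrite -convol_itv//; last 2 first.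
- exact: measurable_rlker.
- by move=> u u0; rewrite rlker_lt0.
by rewrite convol_rlker// gt_eqF.
Qed.

Lemma measurable_rlkerB (a t : R) (D : set R) : measurable_fun D (fun u => rlker a (t - u)).
Proof.
apply: measurable_funTS; apply: measurableT_comp; first exact: measurable_rlker.
exact: measurable_funB.
Qed.

Lemma integrable_rlkerM (a b t : R) : 0 < a -> 0 < b -> 0 < t ->
  mu.-integrable `]0, t[ (EFin \o (fun u => rlker a (t - u) * rlker b u)).
Proof.
move=> a0 b0 t0; apply/integrableP; split.
  apply/measurable_EFinP; apply: measurable_funM; last exact: measurable_rlker.
  exact: measurable_rlkerB.
under eq_integral.
  move=> u _; rewrite /= ger0_norm; last by rewrite mulr_ge0 ?rlker_ge0.
  over.
by rewrite integral_rlkerM// ltry.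
Qed.

Lemma integrable_rlkerB (a t : R) : 0 < a -> 0 < t ->
  mu.-integrable `]0, t[ (EFin \o (fun u => rlker a (t - u))).
Proof.
move=> a0 t0; apply: eq_integrable (integrable_rlkerM a0 ltr01 t0) => //.
move=> u; rewrite inE/= in_itv/= => /andP[u0 _].
by rewrite rlker1 (ltW u0) mulr1.
Qed.

Variable alpha : R.
Hypothesis alpha0 : 0 < alpha.
Local Notation phi := (mlmon alpha).
Local Notation G := (mlseries alpha).

(** The Riemann-Liouville integral of order [alpha].  Unlike [convol], it is
    real valued and applies to functions of any sign. *)
Definition fracint (f : R -> R) (t : R) : R :=
  \int[mu]_(u in `]0, t[) (rlker alpha (t - u) * f u).

Definition shift_seq (b : nat -> R) (l : nat) : R := if l is l'.+1 then b l' else 0.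

Lemma expbounded_shift b : expbounded b -> expbounded (shift_seq b).
Proof.
move=> [A [C [A0 C0 bC]]]; exists A, (1 + C); split => //; first by lra.
case=> [|l]/=; first by rewrite normr0 expr0 mulr1.
apply: (le_trans (bC l)); rewrite ler_wpM2l// exprS.
have h : C ^+ l <= (1 + C) ^+ l by apply: lerXn2r; rewrite ?nnegrE; lra.
apply: (le_trans h); apply: ler_peMl; [by rewrite exprn_ge0//; lra|lra].
Qed.

Lemma mlmonSE l : phi l.+1 = rlker (alpha + (1 + alpha * l%:R)).
Proof. by rewrite /mlmon -natr1; congr rlker; ring. Qed.

Lemma fracint_mlmon l t : 0 < t -> fracint (phi l) t = phi l.+1 t.
Proof.
move=> t0; rewrite mlmonSE /fracint /Rintegral.
by rewrite (integral_rlkerM alpha0 (ml_index_gt0 alpha0 l) t0).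
Qed.

Lemma fracint_mlseries b t : expbounded b -> 0 < t ->
  fracint (G b) t = G (shift_seq b) t.
Proof.
move=> hb t0.
have [] := @integral_weighted_series `]0, t[%classic (fun u => rlker alpha (t - u))
  (fun l u => b l * phi l u) (fun l => `|b l * phi l t|).
- exact: measurable_itv.
- exact: integrable_rlkerB.
- by move=> l; apply: measurable_funM => //; exact: measurable_rlker.
- move=> l u /=; rewrite in_itv/= => /andP[_ ut]; rewrite !normrM ler_wpM2l//.
  by rewrite !ger0_norm ?mlmon_ge0// mlmon_le// ltW.
- exact: is_cvg_mlseries_norm.
move=> _ H; apply/esym/cvg_lim => //.
rewrite -(cvg_shiftS (series _)) /=.
rewrite -/(G _) in H.
apply: cvg_trans H; apply: near_eq_cvg; apply: nearW => n.
rewrite /series/= big_nat_recl//= mul0r add0r; apply: eq_bigr => l _.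
transitivity (b l * fracint (phi l) t); last by rewrite fracint_mlmon.
rewrite /fracint -RintegralZl//; last exact: (integrable_rlkerM alpha0 (ml_index_gt0 alpha0 _) t0).
by apply: eq_Rintegral => u _; ring.
Qed.

(** The comparison functions [mlmon k] are carried to one another by
    [fracint]; this makes the bound iterable. *)
Lemma fracint_le (f : R -> R) (B : R) k (t : R) : 0 < t -> 0 <= B ->
  measurable_fun [set: R] f -> (forall u, 0 < u < t -> `|f u| <= B * phi k u) ->
  mu.-integrable `]0, t[ (EFin \o (fun u => rlker alpha (t - u) * f u)) /\
  `|fracint f t| <= B * phi k.+1 t.
Proof.
move=> t0 B0 mf fB.
have iB : mu.-integrable `]0, t[ (EFin \o (fun u => B * (rlker alpha (t - u) * phi k u))).
  by apply: integrable_mull => //; exact: (integrable_rlkerM alpha0 (ml_index_gt0 alpha0 _) t0).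
have le u : 0 < u < t -> `|rlker alpha (t - u) * f u| <= B * (rlker alpha (t - u) * phi k u).
  by move=> ut; rewrite normrM ger0_norm ?rlker_ge0// mulrCA ler_wpM2l ?rlker_ge0// fB.
have i1 : mu.-integrable `]0, t[ (EFin \o (fun u => rlker alpha (t - u) * f u)).
  apply: le_integrable iB => //.
    apply/measurable_EFinP; apply: measurable_funM; last exact: measurable_funTS.
    exact: measurable_rlkerB.
  move=> u /=; rewrite in_itv/= => ut; rewrite lee_fin; apply: (le_trans (le u ut)).
  exact: ler_norm.
split=> //; rewrite -fracint_mlmon// /fracint.
rewrite -RintegralZl//; last exact: (integrable_rlkerM alpha0 (ml_index_gt0 alpha0 _) t0).
apply: (le_trans (le_normr_Rintegral _ i1)) => //.
apply: le_Rintegral => //.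
- exact: (integrable_norm i1).
Qed.

(** Iterating [fracint_le] from the constant bound gives
    [|h t| <= B * mlmon k t] for all [k], and the right-hand side tends to 0. *)
Lemma volterra_uniq (h : R -> R) (B T : R) : measurable_fun [set: R] h -> 0 <= B ->
  (forall t, 0 < t <= T -> `|h t| <= B) ->
  (forall t, 0 < t <= T -> h t = - fracint h t) ->
  forall t, 0 < t <= T -> h t = 0.
Proof.
move=> mh B0 hB hJ t tT.
have H k : forall t, 0 < t <= T -> `|h t| <= B * phi k t.
  elim: k => [|k IH] u /andP[u0 uT].
    by rewrite /mlmon mulr0 addr0 rlker1 (ltW u0) mulr1 hB// u0.
  rewrite hJ ?u0// normrN.
  apply: (fracint_le u0 B0 mh _).2 => v /andP[v0 vu]; apply: IH.
  by rewrite v0 (le_trans (ltW vu)).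
have [D D0 HD] := mlmon_growth alpha0 t ler01.
apply/eqP; rewrite -normr_le0; apply/ler_addgt0Pr => e e0; rewrite add0r.
have [N /(_ N (leqnn N)) /ltW] := geometric_half_lt (B * D) e0; apply: le_trans.
apply: (le_trans (H N t tT)).
rewrite -mulrA ler_wpM2l//; have := HD N; rewrite expr1n mul1r; exact.
Qed.

End fracint.

(** * Caputo differentiation *)

Section caputo.
Context {R : realType}.
Local Notation mu := (@lebesgue_measure R).
Variable alpha : R.
Hypothesis alpha0 : 0 < alpha.
Local Notation phi := (mlmon alpha).
Local Notation G := (mlseries alpha).

Lemma convol_fracint (f : R -> R) (B t : R) : 0 < t -> 0 <= B ->
  measurable_fun [set: R] f -> (forall u, u < 0 -> f u = 0) ->
  (forall u, 0 < u < t -> `|f u| <= B) ->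
  convol (rlker alpha) f t = (fracint alpha f t)%:E.
Proof.
move=> t0 B0 mf f0 fB; rewrite convol_itv// /fracint /Rintegral fineK//.
apply: integrable_fin_num => //.
apply: (fracint_le alpha0 (k := 0) t0 B0 mf _).1 => u /[dup] /fB uB /andP[u0 _].
by rewrite /mlmon mulr0 addr0 rlker1 (ltW u0) mulr1.
Qed.

Lemma mlseries_shift0 b : G (shift_seq b) 0 = 0.
Proof.
apply: cvg_lim => //.
rewrite (_ : series _ = cst 0); first exact: cvg_cst.
apply/funext => n; rewrite /series/= big1// => -[|l] _ /=; first by rewrite mul0r.
by rewrite mlmonE// powR0 ?gt_eqF// exprS !mul0r mulr0.
Qed.

(** Holds for every real [t]: both sides vanish for [t <= 0]. *)
Lemma convol_mlseries b t : expbounded b ->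
  convol (rlker alpha) (G b) t = (G (shift_seq b) t)%:E.
Proof.
move=> hb; have [t0|t0] := ltP 0 t; last first.
  rewrite convol_le0//; last by move=> u; exact: mlseries_lt0.
  move: t0; rewrite le_eqVlt => /predU1P[->|t0]; first by rewrite mlseries_shift0.
  by rewrite mlseries_lt0.
have [A [C [A0 C0 bC]]] := hb.
rewrite (@convol_fracint _ (A * G (fun l => C ^+ l) t)) ?fracint_mlseries//.
- apply: mulr_ge0 => //; apply: (le_trans (normr_ge0 (G (fun l => C ^+ l) t))).
  rewrite -[leRHS]mul1r; apply: mlseries_bound => // l.
  by rewrite mul1r ger0_norm// exprn_ge0.
- exact: measurable_mlseries.
- by move=> u; exact: mlseries_lt0.
- by move=> u /andP[_ ut]; apply: mlseries_bound => //; exact: ltW.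
Qed.

(** Coefficients of a power series with infinite radius of convergence. *)
Definition entire_coef (f : nat -> R) := forall K : R, 0 <= K ->
  exists2 B, 0 <= B & forall l, `|f l| * K ^+ l <= B * 2^-1 ^+ l.

Lemma entire_coef_cvg_norm f K : entire_coef f -> 0 <= K ->
  cvgn (series (fun l => `|f l| * K ^+ l)).
Proof.
move=> hf K0; have [B B0 HB] := hf K K0.
apply: (@series_le_cvg _ _ (geometric B 2^-1)) => [l|l|//|].
- by rewrite mulr_ge0// exprn_ge0.
- by rewrite mulr_ge0 ?exprn_ge0// invr_ge0.
- exact: is_cvg_geometric_half.
Qed.

Lemma entire_coef_cvg f x : entire_coef f -> cvgn (pseries f x).
Proof.
move=> hf; apply: normed_cvg.
have := entire_coef_cvg_norm hf (normr_ge0 x).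
by under eq_fun do rewrite -normrX -normrM.
Qed.

(** The factor [l + 1] brought down by differentiation is at most
    [2 ^ (l + 1)], which is absorbed by doubling the radius. *)
Lemma entire_coef_diffs f : entire_coef f -> entire_coef (pseries_diffs f).
Proof.
move=> hf K K0; have K20 : 0 <= 2 * (K + 1) by lra.
have [B B0 HB] := hf _ K20; exists B => // l.
have := HB l.+1; rewrite exprMn mulrCA => H.
rewrite /pseries_diffs normrM ger0_norm//.
apply: (@le_trans _ _ (B * 2^-1 ^+ l.+1)); last first.
  by apply: ler_wpM2l => //; rewrite exprS ler_piMl ?exprn_ge0 ?invr_ge0// invf_le1 ?ler1n.
apply: le_trans H; rewrite -mulrA; apply: ler_pM => //.
- by rewrite mulr_ge0// exprn_ge0.
- by rewrite -natrX ler_nat ltnW// ltn_expl.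
- apply: ler_wpM2l => //; rewrite exprS.
  apply: (@le_trans _ _ ((K + 1) ^+ l)).
    by apply: lerXn2r; rewrite ?nnegrE; lra.
  by apply: ler_peMl; [by rewrite exprn_ge0//; lra|lra].
Qed.

(** For [t >= 0] the series [mlseries b t] is a power series in
    [t ^ alpha], with these coefficients; this gives access to termwise
    differentiation. *)
Definition mlcoef (b : nat -> R) (l : nat) : R := b l / Gamma (1 + alpha * l%:R).

Lemma entire_mlcoef b : expbounded b -> entire_coef (mlcoef b).
Proof.
move=> [A [C [A0 C0 bC]]] K K0.
have [B B0 HB] := Gamma_growth alpha0 (mulr_ge0 C0 K0).
exists (A * B); first exact: mulr_ge0.
move=> l; rewrite /mlcoef normrM normfV (gtr0_norm (Gamma_gt0 (ml_index_gt0 alpha0 l))).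
apply: (@le_trans _ _ (A * ((C * K) ^+ l / Gamma (1 + alpha * l%:R)))).
  rewrite exprMn mulrAC !mulrA -!mulrA; rewrite !mulrA ler_pM2r; last by rewrite invr_gt0 Gamma_gt0 ?ml_index_gt0.
  by apply: ler_wpM2r; rewrite ?exprn_ge0// bC.
by rewrite -mulrA ler_wpM2l.
Qed.

Lemma mlseriesE b t : 0 <= t -> G b t = limn (pseries (mlcoef b) (t `^ alpha)).
Proof.
move=> t0; congr (limn (series _)); apply/funext => l.
by rewrite mlmonE// /mlcoef mulrA mulrAC.
Qed.

Lemma mlcoef_diffs b l : alpha * pseries_diffs (mlcoef b) l = b l.+1 / Gamma (alpha + alpha * l%:R).
Proof.
rewrite /pseries_diffs /mlcoef.
have g0 : 0 < alpha + alpha * l%:R by rewrite ltr_pwDl// mulr_ge0// ltW.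
rewrite (_ : 1 + alpha * l.+1%:R = (alpha + alpha * l%:R) + 1); last by rewrite -natr1; ring.
rewrite GammaS// -natr1; have := Gamma_gt0 g0; set g := Gamma _ => gg0.
have l0 : 0 < l%:R + 1 :> R by rewrite ltr_wpDl.
by field; rewrite !gt_eqF//= (_ : alpha + alpha * l%:R = alpha * (l%:R + 1)) ?mulr_gt0//; ring.
Qed.

(** The chain rule for the power series in [u ^ alpha]; for [alpha < 1] the
    second factor is singular at 0 but integrable. *)
Definition dmlseries b u : R :=
  limn (pseries (pseries_diffs (mlcoef b)) (u `^ alpha)) * (alpha * u `^ (alpha - 1)).

Lemma is_derive_mlseries (f : R -> R) b (u : R) : expbounded b -> (forall t : R, 0 < t -> f t = G b t) ->
  0 < u -> is_derive u (1 : R) f (dmlseries b u).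
Proof.
move=> hb fG u0.
pose c := mlcoef b; have hc : entire_coef c by exact: entire_mlcoef.
pose x := u `^ alpha.
have h1 : is_derive x (1 : R) (fun x : R => limn (pseries c x)) (limn (pseries (pseries_diffs c) x)).
  apply: (@pseries_snd_diffs _ c (`|x| + 1)).
  - exact: entire_coef_cvg.
  - exact/entire_coef_cvg/entire_coef_diffs.
  - exact/entire_coef_cvg/entire_coef_diffs/entire_coef_diffs.
  - by rewrite [ltRHS]ger0_norm ?ltrDl// addr_ge0.
have h2 := is_derive1_powR alpha u0.
have h3 : is_derive u (1 : R) ((fun x : R => limn (pseries c x)) \o (fun v : R => v `^ alpha)) (dmlseries b u).
  by rewrite /dmlseries; exact: (@is_derive1_comp R _ (fun v : R => v `^ alpha) u _ _ h1 h2).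
apply: near_eq_is_derive h3.
near=> v; have v0 : 0 < v by near: v; exact: lt_nbhsr.
by rewrite /= fG// mlseriesE// ltW.
Unshelve. all: by end_near. Qed.

Lemma dmlseriesM b (u c : R) :
  c * dmlseries b u =
  (c * (alpha * u `^ (alpha - 1))) *
    limn (series (fun l => pseries_diffs (mlcoef b) l * (u `^ alpha) ^+ l)).
Proof. by rewrite /dmlseries mulrCA mulrC. Qed.

(** Termwise, the derivative of [mlmon (l + 1)] is the kernel of order
    [alpha (l + 1)], and its convolution with the kernel of order [1 - alpha] is
    [mlmon l] by the semigroup law.  The exchange of sum and integral uses the
    weight [(t - u) ^ (- alpha) * u ^ (alpha - 1)], singular at both ends. *)
Lemma caputo_mlseries (f : R -> R) b (t : R) : alpha <= 1 -> expbounded b ->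
  (forall t : R, 0 < t -> f t = G b t) -> 0 < t ->
  is_caputo_derive alpha f t (G (fun l => b l.+1) t).
Proof.
move=> a1 hb fG t0; rewrite /is_caputo_derive.
have hd := entire_coef_diffs (entire_mlcoef hb).
have [al1|aln1] := eqVneq alpha 1.
  rewrite (_ : G (fun l => b l.+1) t = dmlseries b t).
    exact: is_derive_mlseries.
  apply/esym; rewrite /dmlseries al1 subrr powRr0 !mulr1 /mlseries; congr (limn (series _)).
  apply/funext => l /=; have := mlcoef_diffs b l.
  rewrite mlmonE ?ltW// al1 mul1r => ->.
  by rewrite mulrA mulrAC.
have a1' : 0 < 1 - alpha by rewrite subr_gt0 lt_neqAle aln1.
have G1 := Gamma_gt0 a1'; have G2 := Gamma_gt0 alpha0.
pose g l u := pseries_diffs (mlcoef b) l * (u `^ alpha) ^+ l.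
pose w u := (t - u) `^ (- alpha) * (alpha * u `^ (alpha - 1)).
pose A l := `|pseries_diffs (mlcoef b) l| * (t `^ alpha) ^+ l.
have iw : mu.-integrable `]0, t[ (EFin \o w).
  apply: (@eq_integrable _ _ _ mu _ _ (EFin \o (fun u => (Gamma (1 - alpha) * Gamma alpha * alpha) *
      (rlker (1 - alpha) (t - u) * rlker alpha u)))) => //.
    move=> u; rewrite inE/= in_itv/= => /andP[u0 ut]; congr EFin; rewrite /w /rlker.
    rewrite (ltW u0) subr_ge0 (ltW ut) (_ : 1 - alpha - 1 = - alpha); last by ring.
    by field; rewrite (gt_eqF G1) (gt_eqF G2).
  by apply: integrable_mull => //; exact: integrable_rlkerM.
have [||l u|| H1 H2] := @integral_weighted_series _ `]0, t[%classic w g A _ iw.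
- exact: measurable_itv.
- move=> l; apply: measurable_funM => //; apply: measurable_funX.
  by apply: measurable_funTS; exact: measurable_powR.
- rewrite /= in_itv/= => /andP[u0 ut]; rewrite normrM ler_wpM2l//.
  rewrite ger0_norm ?exprn_ge0 ?powR_ge0//; apply: lerXn2r; rewrite ?nnegrE ?powR_ge0//.
  by apply: ge0_ler_powR; rewrite ?nnegrE ltW.
- by apply: entire_coef_cvg_norm => //; exact: powR_ge0.
have E u : u \in `]0, t[%classic ->
    (t - u) `^ (- alpha) * (f^`())%classic u = w u * limn (series (fun l => g l u)).
  rewrite inE/= in_itv/= => /andP[u0 ut].
  by rewrite derive1E (@derive_val _ _ _ _ _ _ _ (is_derive_mlseries hb fG u0)) dmlseriesM.
split.
- by move=> u /andP[u0 _]; apply: (@ex_derive _ _ _ _ _ _ _ (is_derive_mlseries hb fG u0)).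
- by apply: eq_integrable H1 => // u /E /= ->.
- transitivity ((Gamma (1 - alpha))^-1 * \int[mu]_(u in `]0, t[) (w u * limn (series (fun l => g l u)))).
    by congr (_ * _); apply: eq_Rintegral => u /E.
  have H3 : series (fun l => \int[mu]_(u in `]0, t[) (w u * g l u)) @ \oo -->
      Gamma (1 - alpha) * G (fun l => b l.+1) t.
    have hbS : expbounded (fun l => b l.+1).
      have [A' [C [A0 C0 bC]]] := hb; exists (A' * C), C; split => //; first exact: mulr_ge0.
      by move=> l; rewrite -mulrA -exprS.
    rewrite -mlseriesZ//.
    rewrite [X in series X](_ : _ = (fun l => Gamma (1 - alpha) * b l.+1 * phi l t)); last first.
      apply/funext => l.
      have g0 : 0 < alpha + alpha * l%:R by rewrite ltr_pwDl// mulr_ge0// ltW.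
      have -> : phi l t = \int[mu]_(u in `]0, t[) (rlker (1 - alpha) (t - u) * rlker (alpha + alpha * l%:R) u).
        rewrite /Rintegral (integral_rlkerM a1' g0 t0) /mlmon.
        by rewrite (_ : 1 - alpha + (alpha + alpha * l%:R) = 1 + alpha * l%:R)//; ring.
      rewrite -RintegralZl//; last exact: integrable_rlkerM.
      apply: eq_Rintegral => u; rewrite inE/= in_itv/= => /andP[u0 ut].
      transitivity ((alpha * pseries_diffs (mlcoef b) l) *
          ((t - u) `^ (- alpha) * u `^ (alpha - 1) * (u `^ alpha) ^+ l)).
        by rewrite /w /g; ring.
      rewrite mlcoef_diffs.
      rewrite /rlker (ltW u0) subr_ge0 (ltW ut) (_ : 1 - alpha - 1 = - alpha); last by ring.
      rewrite -powR_mulrn ?powR_ge0// -powRrM.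
      have -> : alpha + alpha * l%:R - 1 = (alpha - 1) + alpha * l%:R by ring.
      rewrite (@powRD _ u (alpha - 1) (alpha * l%:R)); last by rewrite (gt_eqF u0) implybT.
      by field; rewrite (gt_eqF G1) (gt_eqF (Gamma_gt0 g0)).
    by apply: cvg_mlseries => //; exact: expboundedZ.
  have -> : \int[mu]_(u in `]0, t[) (w u * limn (series (fun l => g l u))) =
      Gamma (1 - alpha) * G (fun l => b l.+1) t by exact: cvg_unique H2 H3.
  by rewrite mulrA mulVf ?mul1r// (gt_eqF G1).
Qed.

End caputo.

(** * Independence of partial sums *)

Section independence.
Context {R : realType} d {T : measurableType d} (P : probability T R).

Lemma measurable_RV (d' : measure_display) (U : measurableType d') (Y : {RV P >-> U}) (A : set U) :
  measurable A -> measurable (Y @^-1` A).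
Proof. by move=> mA; rewrite -[X in measurable X]setTI; apply: measurable_funPT. Qed.

(** Measurable rectangles are stable under intersection and generate the
    product sigma-algebra. *)
Lemma rectangle_unique (m1 m2 : {measure set (R * R) -> \bar R}) :
  (m1 setT < +oo)%E ->
  (forall A B : set R, measurable A -> measurable B -> m1 (A `*` B) = m2 (A `*` B)) ->
  forall C, measurable C -> m1 C = m2 C.
Proof.
move=> m1oo m12.
pose G : set (set (R * R)) :=
  [set C | exists A, measurable A /\ exists B, measurable B /\ C = A `*` B].
apply: (measure_unique G (fun=> setT)) => //.
- rewrite measurable_prod_measurableType //; congr (<<s _ >>).
  rewrite predeqE => C; split => [[A mA [B mB <-]]|[A [mA [B [mB ->]]]]].
    by exists A; split => //; exists B.
  by exists A => //; exists B.
- move=> /= _ _ [X1 [mX1 [X2 [mX2 ->]]]] [Y1 [mY1 [Y2 [mY2 ->]]]].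
  rewrite -setXI; exists (X1 `&` Y1); split; first exact: measurableI.
  by exists (X2 `&` Y2); split => //; exact: measurableI.
- by move=> n; exists setT; split => //; exists setT; split => //; rewrite setXTT.
- by rewrite bigcup_const//; exists 0%N.
- by move=> _ [A [mA [B [mB ->]]]]; exact: m12.
Qed.

(** Independence of an event from all rectangles extends to all Borel sets of
    the plane, since both sides are finite measures in [C]. *)
Lemma indep_pair_event (Y Z : {RV P >-> R}) (E : set T) : measurable E ->
  (forall A B : set R, measurable A -> measurable B ->
    P (Y @^-1` A `&` Z @^-1` B `&` E) = (P (Y @^-1` A `&` Z @^-1` B) * P E)%E) ->
  forall C : set (R * R), measurable C ->
    P ((fun w => (Y w, Z w)) @^-1` C `&` E) = (P ((fun w => (Y w, Z w)) @^-1` C) * P E)%E.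
Proof.
move=> mE YZE.
pose W w := (Y w, Z w).
have mW : measurable_fun setT W by exact: measurable_fun_pair.
pose m1 : {measure set (R * R) -> \bar R} := pushforward (mrestr P mE) W.
have PE : P E = ((fine (P E))%:E)%E by rewrite fineK// fin_num_measure.
have p0 : 0 <= fine (P E) by rewrite fine_ge0.
pose m2 : {measure set (R * R) -> \bar R} := mscale (NngNum p0) (pushforward P W).
move=> C mC.
have H : m1 mW C = m2 mW C.
  apply: rectangle_unique => //.
  - rewrite /m1/= /pushforward/= /mrestr preimage_setT setTI.
    by apply: (le_lt_trans (probability_le1 _ mE)); exact: ltry.
  - move=> A B mA mB.
    transitivity (P (Y @^-1` A `&` Z @^-1` B) * P E)%E; first exact: YZE.
    by rewrite muleC {1}PE.
transitivity (m1 mW C) => //; rewrite H.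
by rewrite muleC PE.
Qed.

(** The joint law of independent variables is the product of their laws, so
    the probability of [C] can be computed by conditioning on the first one. *)
Lemma indep_law (Y Z : {RV P >-> R}) :
  (forall A B : set R, measurable A -> measurable B ->
    P (Y @^-1` A `&` Z @^-1` B) = (P (Y @^-1` A) * P (Z @^-1` B))%E) ->
  forall C : set (R * R), measurable C ->
    P [set w | C (Y w, Z w)] = (\int[P]_w P [set w' | C (Y w, Z w')])%E.
Proof.
move=> YZ C mC.
pose W w := (Y w, Z w).
have mW : measurable_fun setT W by exact: measurable_fun_pair.
pose m : {measure set (R * R) -> \bar R} := pushforward P W.
have H : ((distribution P Y \x distribution P Z) C = m mW C)%E.
  by apply: product_measure_unique => // A B mA mB; exact: YZ.
transitivity (m mW C) => //; rewrite -H.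
rewrite /product_measure1 ge0_integral_distribution//.
  apply: eq_integral => w _; rewrite /= /distribution /pushforward /=; congr (P _).
  by apply/seteqP; split=> w' /=; rewrite /xsection/= inE.
exact: measurable_fun_xsection.
Qed.

Definition partial_sum (X : nat -> {RV P >-> R}) (n : nat) : {RV P >-> R} :=
  (\sum_(k < n) X k)%R.

Lemma partial_sumE X n w : partial_sum X n w = \sum_(k < n) X k w.
Proof. by rewrite /partial_sum mfun_sum. Qed.

Lemma partial_sumS X n w : partial_sum X n.+1 w = partial_sum X n w + X n w.
Proof. by rewrite !partial_sumE big_ord_recr. Qed.

(** Induction on [n]: the sum of [n + 1] terms is a function of the sum of [n]
    terms and of the next one, and this pair is independent of the later ones.
    The family [J] of later variables is arbitrary so that the next term can be
    moved into it. *)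
Lemma partial_sum_indep_tail (X : nat -> {RV P >-> R}) n :
  mutually_independent X ->
  forall (J : {fset nat}) (B : nat -> set R) (A : set R), measurable A ->
    (forall i, measurable (B i)) -> (forall i, i \in J -> (n <= i)%N) ->
    P (partial_sum X n @^-1` A `&` \bigcap_(i in [set` J]) (X i @^-1` B i)) =
    (P (partial_sum X n @^-1` A) * P (\bigcap_(i in [set` J]) (X i @^-1` B i)))%E.
Proof.
move=> indX; elim: n => [|n IH] J B A mA mB nJ.
  have [A0|A0] := pselect (A 0).
    rewrite (_ : _ @^-1` A = setT) ?setTI ?probability_setT ?mul1e//.
    by apply/seteqP; split=> // w _ /=; rewrite partial_sumE big_ord0.
  rewrite (_ : _ @^-1` A = set0) ?set0I ?measure0 ?mul0e//.
  by apply/seteqP; split=> // w /=; rewrite partial_sumE big_ord0.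
set E := \bigcap_(i in _) _.
have mE (J' : {fset nat}) (B' : nat -> set R) : (forall i, measurable (B' i)) ->
    measurable (\bigcap_(i in [set` J']) (X i @^-1` B' i)).
  by move=> mB'; apply: fin_bigcap_measurable => // i _; exact: measurable_RV.
have nJn : n \notin J by apply/negP => /nJ; rewrite ltnn.
pose C : set (R * R) := [set z | A (z.1 + z.2)].
have mC : measurable C.
  rewrite -[X in measurable X]setTI.
  by apply: (measurable_funD (f := fst) (g := snd)).
have SE : partial_sum X n.+1 @^-1` A = (fun w => (partial_sum X n w, X n w)) @^-1` C.
  by apply/seteqP; split=> w /=; rewrite /C/= partial_sumS.
rewrite SE; apply: indep_pair_event mC; first exact: mE.
move=> A' B' mA' mB'.
pose B2 i := if i == n then B' else B i.
have mB2 i : measurable (B2 i) by rewrite /B2; case: ifP.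
have capE : X n @^-1` B' `&` E = \bigcap_(i in [set` (n |` J)%fset]) (X i @^-1` B2 i).
  apply/seteqP; split=> w /=.
    move=> [Xn EJ] i /=; rewrite /B2 !inE; case: eqP => [->//|_ /= iJ]; exact: EJ.
  move=> H; split.
    by have := H n; rewrite /= /B2 eqxx; apply; rewrite !inE eqxx.
  move=> i /= iJ; have := H i; rewrite /= /B2 ifN; last by apply: contraNneq nJn => <-.
  by apply; rewrite !inE iJ orbT.
have cap1 : X n @^-1` B' = \bigcap_(i in [set` [fset n]%fset]) (X i @^-1` B2 i).
  apply/seteqP; split=> w /=.
    by move=> Xn i /=; rewrite !inE => /eqP ->; rewrite /B2 eqxx.
  by move=> H; have := H n; rewrite /= /B2 eqxx; apply; rewrite !inE.
rewrite -setIA capE IH//; last first.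
  by move=> i; rewrite !inE => /orP[/eqP->//|/nJ/ltnW].
rewrite indX; last by [].
rewrite big_fsetU1//= {1}/B2 eqxx.
have -> : (\prod_(i <- J) P (X i @^-1` B2 i) = P E)%E.
  rewrite /E indX; last by move=> i _; exact: mB.
  rewrite big_seq [RHS]big_seq; apply: eq_bigr => i iJ.
  by rewrite /B2 ifN//; apply: contraNneq nJn => <-.
rewrite {2}cap1 IH// -?cap1 ?muleA//.
by move=> i; rewrite !inE => /eqP->.
Qed.

Lemma partial_sum_indep (X : nat -> {RV P >-> R}) n : mutually_independent X ->
  forall A B : set R, measurable A -> measurable B ->
    P (partial_sum X n @^-1` A `&` X n @^-1` B) = (P (partial_sum X n @^-1` A) * P (X n @^-1` B))%E.
Proof.
move=> indX A B mA mB.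
have cap1 : X n @^-1` B = \bigcap_(i in [set` [fset n]%fset]) (X i @^-1` B).
  apply/seteqP; split=> w /=; first by move=> Xn i /=; rewrite !inE => /eqP ->.
  by move=> H; apply: (H n); rewrite /= !inE.
rewrite cap1 (partial_sum_indep_tail indX _ (B := fun=> B))//.
by move=> i; rewrite !inE => /eqP->.
Qed.
End independence.

(** * The renewal equation *)

Section renewal.
Context {R : realType} d {T : measurableType d} (P : probability T R).
Local Notation mu := (@lebesgue_measure R).

Lemma measurable_fun_le_set d' (U : measurableType d') (f : U -> R) (t : R) :
  measurable_fun setT f -> measurable [set z | f z <= t].
Proof.
move=> mf; have := mf measurableT `]-oo, t]%classic (measurable_itv _).
by rewrite setTI; congr measurable; apply/seteqP; split=> z /=; rewrite in_itv.
Qed.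

Lemma measurable_fun_gt_set d' (U : measurableType d') (f : U -> R) (t : R) :
  measurable_fun setT f -> measurable [set z | t < f z].
Proof.
move=> mf; have := mf measurableT `]t, +oo[%classic (measurable_itv _).
by rewrite setTI; congr measurable; apply/seteqP; split=> z /=; rewrite in_itv/= andbT.
Qed.

Lemma ae_eq_prob (A B : set T) : measurable A -> measurable B ->
  {ae P, forall w, A w <-> B w} -> P A = P B.
Proof.
move=> mA mB [N [mN N0 NAB]].
suff H A' B' : measurable A' -> measurable B' -> A' `&` ~` N `<=` B' -> (P A' <= P B')%E.
  apply/eqP; rewrite eq_le; apply/andP; split; apply: H => // w [Aw Nw];
    apply: contrapT => Bw; apply: Nw; apply: NAB => /=; tauto.
move=> mA' mB' AB; apply: (@le_trans _ _ (P (B' `|` N))).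
  apply: le_measure; rewrite ?inE//; first exact: measurableU.
  move=> w Aw; have [?|nN] := pselect (N w); first by right.
  by left; apply: AB.
apply: (le_trans (measureU2 P mB' mN)).
by rewrite [X in (_ + X <= _)%E](_ : _ = 0%E) ?adde0.
Qed.

Variables (alpha : R) (X : nat -> {RV P >-> R}).
Hypothesis alpha0 : 0 < alpha.
Hypothesis indX : mutually_independent X.
Hypothesis mlX : forall k, is_mittag_leffler_rv alpha 1 (X k).
Local Notation phi := (mlmon alpha).
Local Notation G := (mlseries alpha).
Local Notation S := (partial_sum X).

Lemma ae_forall_nat (E : nat -> T -> Prop) :
  (forall k, {ae P, forall w, E k w}) -> {ae P, forall w, forall k, E k w}.
Proof.
move=> H; have := negligible_bigcup H.
apply: negligibleS => w /= /existsNP[k Ek]; by exists k.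
Qed.

Lemma ae_interarrival_gt0 : {ae P, forall w, forall k, 0 < X k w}.
Proof. by apply: ae_forall_nat => k; exact: (mlX k).1. Qed.

Definition altsign (l : nat) : R := (-1) ^+ l.

Lemma expbounded_altsign : expbounded altsign.
Proof. by exists 1, 1; split => // l; rewrite /altsign normrX normrN1 !expr1n mul1r. Qed.

Definition deltaseq (l : nat) : R := (l == 0)%N%:R.

Lemma expbounded_deltaseq : expbounded deltaseq.
Proof.
exists 1, 1; split => // l; rewrite /deltaseq expr1n mul1r.
by case: eqP => _; rewrite ?normr1 ?normr0.
Qed.

Lemma mlseries_delta t : G deltaseq t = (0 <= t)%R%:R.
Proof.
apply: cvg_lim => //; rewrite -(cvg_shiftS (series _)) /=.
apply: (@cvg_trans _ ((fun=> (0 <= t)%R%:R : R) @ \oo)); last exact: cvg_cst.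
apply: near_eq_cvg; apply: nearW => n.
rewrite /series/= big_nat_recl//= big1 ?addr0; last by move=> l _; rewrite /deltaseq mul0r.
by rewrite /deltaseq mul1r /mlmon mulr0 addr0 rlker1.
Qed.

(** The Mittag-Leffler law is the case of coefficients [(-1)^l]. *)
Lemma survivalE k x : P [set w | 0 <= x < X k w] = (G altsign x)%:E.
Proof.
have [x0|x0] := leP 0 x; last first.
  rewrite mlseries_lt0// (_ : [set _ | _] = set0) ?measure0//.
  by apply/seteqP; split=> // w /=.
rewrite (_ : [set _ | _] = [set w | x < X k w]); last by apply/seteqP; split.
rewrite (mlX k).2// powR1 mul1r /mittag_leffler; congr (limn (series _))%:E.
apply/funext => l; rewrite mlmonE// mulrA; congr (_ / _).
by rewrite -[- _]mulN1r exprMn.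
Qed.

Lemma altsign_ge0 x : 0 <= G altsign x.
Proof. by rewrite -lee_fin -(survivalE 0%N). Qed.

(** [1 - F] and [K_alpha * F] have the same coefficients: with [F] the
    survival function, shifting [(-1)^l] to the right equals subtracting it from
    the series of the constant 1. *)
Lemma cdfE k x : P [set w | X k w <= x] = (G (shift_seq altsign) x)%:E.
Proof.
have [x0|x0] := leP 0 x; last first.
  rewrite mlseries_lt0//; transitivity (P set0); last exact: measure0.
  apply: ae_eq_prob => //; first exact: measurable_fun_le_set.
  have [N [mN N0 HN]] := ae_interarrival_gt0; exists N; split => // w /= h.
  apply: HN => /= /(_ k) Xk; apply: h; split => // ?; lra.
rewrite (_ : [set _ | _] = ~` [set w | 0 <= x < X k w]); last first.
  by apply/seteqP; split=> w /=; rewrite x0/= ltNge; [move=> ->|move/negP/negPn].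
rewrite probability_setC; last first.
  by rewrite x0/=; exact: measurable_fun_gt_set.
rewrite survivalE -EFinB; congr EFin.
have -> : shift_seq altsign = (fun l => deltaseq l + -1 * altsign l).
  apply/funext => -[|l]; rewrite /shift_seq /deltaseq /altsign ?expr0 ?exprS/=; ring.
have hd := expbounded_deltaseq; have ha := expbounded_altsign.
rewrite mlseriesD ?mlseriesZ//; last exact: expboundedZ.
by rewrite mlseries_delta x0 mulN1r.
Qed.

Definition renewal_prob (n : nat) (t : R) : R := fine (P [set w | S n w <= t < S n.+1 w]).

Lemma measurable_renewal_event n t : measurable [set w | S n w <= t < S n.+1 w].
Proof.
rewrite (_ : [set _ | _] = [set w | S n w <= t] `&` [set w | t < S n.+1 w]); last first.
  by apply/seteqP; split=> w /=; [move=> /andP[]|case=> -> ->].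
by apply: measurableI; [exact: measurable_fun_le_set|exact: measurable_fun_gt_set].
Qed.

Lemma EFin_renewal_prob n t : (renewal_prob n t)%:E = P [set w | S n w <= t < S n.+1 w].
Proof. by rewrite fineK// fin_num_measure//; exact: measurable_renewal_event. Qed.

Lemma renewal_prob_ge0 n t : 0 <= renewal_prob n t.
Proof. exact: fine_ge0. Qed.

Lemma renewal_prob_le1 n t : renewal_prob n t <= 1.
Proof.
by rewrite -lee_fin EFin_renewal_prob probability_le1//; exact: measurable_renewal_event.
Qed.

Lemma measurable_altsign : measurable_fun [set: R] (G altsign).
Proof. by apply: measurable_mlseries => //; exact: expbounded_altsign. Qed.

(** By independence, conditioning on [S_n = u] leaves the event that the next
    inter-event time exceeds [v - u], where [F] vanishes if [v < u]. *)
Lemma renewal_probE n v :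
  (renewal_prob n v)%:E = (\int[P]_w (G altsign (v - S n w))%:E)%E.
Proof.
rewrite EFin_renewal_prob.
pose C : set (R * R) := [set z | z.1 <= v < z.1 + z.2].
have mC : measurable C.
  have -> : C = [set z : R * R | z.1 <= v] `&` [set z : R * R | v < z.1 + z.2].
    by apply/seteqP; split=> w /=; rewrite /C/=; [move=> /andP[]|case=> -> ->].
  apply: measurableI; first exact: measurable_fun_le_set.
  by apply: measurable_fun_gt_set; exact: measurable_funD.
have := indep_law (partial_sum_indep n indX) mC.
rewrite (_ : [set w | C _] = [set w | S n w <= v < S n.+1 w]); last first.
  by apply/seteqP; split=> w; rewrite /C /= partial_sumS.
move=> ->; apply: eq_integral => w _; rewrite -(survivalE n); congr (P _).
by apply/seteqP; split=> w'; rewrite /C /= subr_ge0 ltrBlDl.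
Qed.

(** Conditioning on [S_n] expresses the left-hand side by the distribution
    function of one inter-event time, which is [K_alpha * F] by [cdfE]; after the
    translation [v = u + S_n] Tonelli leaves [K_alpha] convolved with the
    expectation of [F (v - S_n)], which is [renewal_prob n v]. *)
Lemma renewal_equation n t : P [set w | S n.+1 w <= t] = convol (rlker alpha) (renewal_prob n) t.
Proof.
pose C : set (R * R) := [set z | z.1 + z.2 <= t].
have mC : measurable C.
  by apply: measurable_fun_le_set; exact: measurable_funD.
have := indep_law (partial_sum_indep n indX) mC.
rewrite (_ : [set w | C _] = [set w | S n.+1 w <= t]); last first.
  by apply/seteqP; split=> w; rewrite /C /= partial_sumS.
move=> ->.
pose F (z : T * R) : \bar R := (rlker alpha (t - z.2) * G altsign (z.2 - S n z.1))%:E.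
have mF : measurable_fun [set: T * R] F.
  apply/measurable_EFinP; apply: measurable_funM.
    apply: measurableT_comp; first exact: measurable_rlker.
    by apply: measurable_funB => //.
  apply: measurableT_comp; first exact: measurable_altsign.
  by apply: measurable_funB => //; exact: measurableT_comp.
have F0 z : (0 <= F z)%E by rewrite lee_fin mulr_ge0 ?rlker_ge0 ?altsign_ge0.
transitivity (\int[P]_w \int[mu]_v F (w, v))%E.
  apply: eq_integral => w _.
  transitivity (P [set w' | X n w' <= t - S n w]).
    by congr (P _); apply/seteqP; split=> w'; rewrite /C/= lerBrDl.
  rewrite cdfE.
  transitivity (convol (rlker alpha) (G altsign) (t - S n w)).
    by rewrite convol_mlseries//; exact: expbounded_altsign.
  rewrite -[LHS](@ge0_integral_shift _ (fun u => (rlker alpha (t - S n w - u) * G altsign u)%:E) (S n w)).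
  - by apply: eq_integral => v _; rewrite /F/=; congr (rlker _ _ * _)%:E; ring.
  - apply/measurable_EFinP; apply: measurable_funM; last exact: measurable_altsign.
    exact: measurable_rlkerB.
  - by move=> u; rewrite lee_fin mulr_ge0 ?rlker_ge0 ?altsign_ge0.
rewrite (fubini_tonelli (m1 := P) (m2 := mu) F mF F0).
apply: eq_integral => v _.
rewrite EFinM renewal_probE -ge0_integralZl//.
- by apply/measurable_EFinP; apply: measurableT_comp; [exact: measurable_altsign|exact: measurable_funB].
- by move=> w _; rewrite lee_fin altsign_ge0.
- by rewrite lee_fin rlker_ge0.
Qed.

End renewal.

(** * Forward differences and Newton series *)

Section newton.
Context {R : realType}.
Variable alpha : R.
Hypothesis alpha0 : 0 < alpha.
Local Notation phi := (mlmon alpha).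
Local Notation G := (mlseries alpha).

(** For [l < n] the truncated subtraction is harmless, the binomial
    coefficient being 0. *)
Definition renewal_coef (n l : nat) : R := (-1) ^+ (l - n) * 'C(l, n)%:R.

Lemma renewal_coef_small n l : (l < n)%N -> renewal_coef n l = 0.
Proof. by move=> ln; rewrite /renewal_coef bin_small// mulr0. Qed.

Lemma norm_renewal_coef n l : `|renewal_coef n l| = 'C(l, n)%:R.
Proof. by rewrite /renewal_coef normrM normrX normrN1 expr1n mul1r ger0_norm. Qed.

Lemma renewal_coef0 l : renewal_coef 0 l = (-1) ^+ l.
Proof. by rewrite /renewal_coef subn0 bin0 mulr1. Qed.

Lemma renewal_coefSS n l : renewal_coef n.+1 l.+1 = renewal_coef n l - renewal_coef n.+1 l.
Proof.
rewrite /renewal_coef subSS binS natrD.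
have [ln|nl] := leqP l n.
  by rewrite (bin_small (m := n.+1)) ?ltnS// !mulr0 subr0 add0r.
by rewrite -(subnSK nl) exprS; ring.
Qed.

(** Pascal's rule, in the form of the Volterra equation for [pi_(n+1)]. *)
Lemma renewal_coef_shift n : renewal_coef n.+1 =
  (fun l => shift_seq (renewal_coef n) l + -1 * shift_seq (renewal_coef n.+1) l).
Proof.
apply/funext => -[|l] /=; first by rewrite renewal_coef_small// mulr0 addr0.
by rewrite renewal_coefSS mulN1r.
Qed.

Lemma sum_bin_le (C : R) K l : 0 <= C -> \sum_(n < K) C ^+ n * 'C(l, n)%:R <= (1 + C) ^+ l.
Proof.
move=> C0; elim: l K => [|l IH] [|K]; rewrite ?big_ord0 ?exprn_ge0 ?addr_ge0//.
  rewrite big_ord_recl big1 ?bin0 ?expr0 ?mulr1 ?addr0// => i _.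
  by rewrite bin_small ?mulr0.
have -> : \sum_(n < K.+1) C ^+ n * 'C(l.+1, n)%:R =
    \sum_(n < K.+1) C ^+ n * 'C(l, n)%:R + C * \sum_(n < K) C ^+ n * 'C(l, n)%:R.
  rewrite !big_ord_recl/= !bin0 -addrA; congr (_ + _).
  rewrite mulr_sumr -big_split/=; apply: eq_bigr => i _.
  by rewrite /bump/= add1n binS natrD exprS; ring.
by rewrite exprS mulrDl mul1r lerD// ler_wpM2l.
Qed.

Lemma expbounded_renewal_coef n : expbounded (renewal_coef n).
Proof.
exists 1, (1 + 1); split => // l; rewrite norm_renewal_coef mul1r.
apply: le_trans (sum_bin_le n.+1 l (ler01 : 0 <= 1 :> R)).
rewrite big_ord_recr/= expr1n mul1r lerDr; apply: sumr_ge0 => i _.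
by rewrite mulr_ge0// exprn_ge0.
Qed.

(** The coefficients of [sum_(n < K) f n * pi_n]; in place [l] they agree with
    those of [fdiff f] as soon as [K] exceeds [l]. *)
Definition partial_fdiff (f : nat -> R) (K l : nat) : R := \sum_(n < K) f n * renewal_coef n l.

(** The [l]-th forward difference of [f] at 0. *)
Definition fdiff (f : nat -> R) (l : nat) : R := partial_fdiff f l.+1 l.

Lemma partial_fdiffE f K l : (l < K)%N -> partial_fdiff f K l = fdiff f l.
Proof.
move=> lK; rewrite /fdiff /partial_fdiff -!(big_mkord xpredT (fun n => f n * renewal_coef n l)).
rewrite (@big_cat_nat _ _ _ l.+1)//= [X in _ + X = _]big_nat_cond [X in _ + X = _]big1 ?addr0// => i.
by rewrite andbT => /andP[li _]; rewrite renewal_coef_small// mulr0.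
Qed.

Lemma partial_fdiff_le f C K l : 0 <= C -> (forall n, `|f n| <= C ^+ n) ->
  `|partial_fdiff f K l| <= (1 + C) ^+ l.
Proof.
move=> C0 fC; apply: le_trans (sum_bin_le K l C0).
apply: (le_trans (ler_norm_sum _ _ _)); apply: ler_sum => n _.
by rewrite normrM norm_renewal_coef ler_wpM2r.
Qed.

Lemma fdiff0 f : fdiff f 0 = f 0.
Proof. by rewrite /fdiff /partial_fdiff big_ord1 renewal_coef0 expr0 mulr1. Qed.

Lemma fdiffS f l : fdiff f l.+1 = fdiff (fun n => f n.+1 - f n) l.
Proof.
rewrite [RHS](_ : _ = \sum_(n < l.+1) f n.+1 * renewal_coef n l - \sum_(n < l.+2) f n * renewal_coef n l); last first.
  rewrite [X in _ - X]big_ord_recr/= renewal_coef_small// mulr0 addr0 -sumrB.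
  by apply: eq_bigr => i _; rewrite mulrBl.
rewrite /fdiff /partial_fdiff big_ord_recl [X in _ - X]big_ord_recl/=.
rewrite !renewal_coef0 exprS mulN1r mulrN opprD addrCA; congr (_ + _).
by rewrite -sumrB; apply: eq_bigr => i _; rewrite /bump/= add1n renewal_coefSS mulrBr.
Qed.

Lemma fdiffD f g l : fdiff (fun n => f n + g n) l = fdiff f l + fdiff g l.
Proof. by rewrite /fdiff /partial_fdiff -big_split; apply: eq_bigr => n _; rewrite mulrDl. Qed.

Lemma fdiffZ k f l : fdiff (fun n => k * f n) l = k * fdiff f l.
Proof. by rewrite /fdiff /partial_fdiff mulr_sumr; apply: eq_bigr => n _; rewrite mulrA. Qed.

Lemma expbounded_fdiff f C : 0 <= C -> (forall n, `|f n| <= C ^+ n) -> expbounded (fdiff f).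
Proof.
move=> C0 fC; exists 1, (1 + C); split => //; first by rewrite addr_ge0.
by move=> l; rewrite mul1r; exact: partial_fdiff_le.
Qed.

(** The remainder after [K] terms is a series whose first [K] coefficients
    vanish and whose others grow at most exponentially, uniformly in [K]; so
    [mlseries_tail] applies. *)
Lemma newton_series f C t : 0 <= C -> (forall n, `|f n| <= C ^+ n) ->
  series (fun n => f n * G (renewal_coef n) t) @ \oo --> G (fdiff f) t.
Proof.
move=> C0 fC.
have hK K : expbounded (partial_fdiff f K).
  exists 1, (1 + C); split => //; first by rewrite addr_ge0.
  by move=> l; rewrite mul1r; exact: partial_fdiff_le.
have SE K : series (fun n => f n * G (renewal_coef n) t) K = G (partial_fdiff f K) t.
  elim: K => [|K IH].
    rewrite /series/= big_geq//.
    rewrite (_ : partial_fdiff f 0 = (fun l => 0 * renewal_coef 0 l)).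
      by rewrite mlseriesZ ?mul0r//; exact: expbounded_renewal_coef.
    by apply/funext => l; rewrite /partial_fdiff big_ord0 mul0r.
  have -> : series (fun n => f n * G (renewal_coef n) t) K.+1 =
      G (partial_fdiff f K) t + f K * G (renewal_coef K) t by rewrite seriesSr IH.
  rewrite -mlseriesZ//; last exact: expbounded_renewal_coef.
  rewrite -mlseriesD//; last by apply: expboundedZ; exact: expbounded_renewal_coef.
  by congr (G _ t); apply/funext => l; rewrite /partial_fdiff big_ord_recr.
have hf := expbounded_fdiff C0 fC.
apply/cvgrPdist_le => e e0.
have eE K : `|G (fdiff f) t - series (fun n => f n * G (renewal_coef n) t) K| <=
    2 * G (fun l => ((1 + C) * 2) ^+ l) t / 2 ^+ K.
  rewrite SE -[- _]mulN1r -(mlseriesZ alpha0 (-1))// -mlseriesD//; last exact: expboundedZ.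
  apply: mlseries_tail => //; rewrite ?addr_ge0 ?ler1n//.
  - move=> l; rewrite mulN1r; apply: (le_trans (ler_normB _ _)).
    by rewrite mulr_natl mulr2n lerD//; exact: partial_fdiff_le.
  - by move=> l lK; rewrite partial_fdiffE// mulN1r subrr.
have [N HN] := geometric_half_lt (2 * G (fun l => ((1 + C) * 2) ^+ l) t) e0.
exists N => // K NK; apply: (le_trans (eE K)).
by have := HN K NK => /= /ltW; apply: le_trans; rewrite -exprVn.
Qed.
End newton.

(** * The law of the renewal process in closed form *)

Section renewal_closed_form.
Context {R : realType} d {T : measurableType d} (P : probability T R).
Local Notation mu := (@lebesgue_measure R).
Variables (alpha : R) (X : nat -> {RV P >-> R}).
Hypothesis alpha0 : 0 < alpha.
Hypothesis indX : mutually_independent X.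
Hypothesis mlX : forall k, is_mittag_leffler_rv alpha 1 (X k).
Local Notation phi := (mlmon alpha).
Local Notation G := (mlseries alpha).
Local Notation S := (partial_sum X).
Local Notation pn := (renewal_prob X).

(** Up to a null set [S_(n+1) <= t] implies [S_n <= t]. *)
Lemma partial_sum_split n t : P [set w | S n w <= t] =
  ((pn n t)%:E + P [set w | (S n.+1 w <= t)%R])%E.
Proof.
rewrite EFin_renewal_prob -measureU; last 3 first.
- exact: measurable_renewal_event.
- exact: measurable_fun_le_set.
- apply/seteqP; split=> // w /= [/andP[_]]; rewrite ltNge => /negP H1 H2; exact: H1.
apply: ae_eq_prob.
- exact: measurable_fun_le_set.
- by apply: measurableU; [exact: measurable_renewal_event|exact: measurable_fun_le_set].
have := ae_interarrival_gt0 mlX; apply: filterS => w X0; split => /=.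
  move=> Sn; rewrite Sn/=; have [|] := leP (S n.+1 w) t; [by right|by left].
move=> [/andP[]//|]; apply: le_trans; rewrite partial_sumS lerDl.
by apply: ltW; exact: X0.
Qed.

Lemma measurable_renewal_prob n : measurable_fun [set: R] (pn n).
Proof.
have mono m : measurable_fun [set: R] (fun t => fine (P [set w | S m w <= t])).
  apply: nondecreasing_measurable => // s t st.
  apply: fine_le; rewrite ?fin_num_measure//; try exact: measurable_fun_le_set.
  apply: le_measure; rewrite ?inE; try exact: measurable_fun_le_set.
  by move=> w /= Sw; exact: le_trans st.
rewrite (_ : pn n = (fun t => fine (P [set w | S n w <= t]) - fine (P [set w | S n.+1 w <= t]))).
  exact: measurable_funB.
apply/funext => t; rewrite partial_sum_split fineD//=; last first.
  by apply: fin_num_measure; exact: measurable_fun_le_set.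
by rewrite addrK.
Qed.

Lemma renewal_prob0 t : pn 0 t = G (renewal_coef 0) t.
Proof.
apply: EFin_inj; rewrite EFin_renewal_prob.
rewrite (_ : [set _ | _] = [set w | 0 <= t < X 0 w]).
  rewrite (survivalE mlX); congr ((G _ t)%:E).
  by apply/funext => l; rewrite renewal_coef0.
by apply/seteqP; split=> w /=; rewrite !partial_sumE big_ord1 big_ord0.
Qed.

Lemma renewal_probS_le0 n t : (forall u, u < 0 -> pn n u = 0) -> t <= 0 -> pn n.+1 t = 0.
Proof.
move=> p0 t0; apply/eqP; rewrite eq_le renewal_prob_ge0 andbT -lee_fin.
rewrite (le_trans _ (_ : P [set w | (S n.+1 w <= t)%R] <= _)%E)//.
  by rewrite partial_sum_split leeDl.
by rewrite (renewal_equation alpha0 indX mlX) convol_le0.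
Qed.

Lemma fracintB (f g : R -> R) (B t : R) : 0 < t -> 0 <= B ->
  measurable_fun [set: R] f -> measurable_fun [set: R] g ->
  (forall u, 0 < u < t -> `|f u| <= B) -> (forall u, 0 < u < t -> `|g u| <= B) ->
  fracint alpha (fun u => f u - g u) t = fracint alpha f t - fracint alpha g t.
Proof.
move=> t0 B0 mf mg fB gB.
have i (h : R -> R) : measurable_fun [set: R] h -> (forall u, 0 < u < t -> `|h u| <= B) ->
    mu.-integrable `]0, t[ (EFin \o (fun u => rlker alpha (t - u) * h u)).
  move=> mh hB; apply: (fracint_le alpha0 (k := 0) t0 B0 mh _).1 => u /[dup] /hB uB /andP[u0 _].
  by rewrite /mlmon mulr0 addr0 rlker1 (ltW u0) mulr1.
rewrite /fracint -RintegralB//; [|exact: i|exact: i].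
by apply: eq_Rintegral => u _; rewrite mulrBr.
Qed.

Lemma mlseries_renewal_coefS n t : G (renewal_coef n.+1) t =
  G (shift_seq (renewal_coef n)) t - G (shift_seq (renewal_coef n.+1)) t.
Proof.
have hs m : expbounded (shift_seq (renewal_coef m) : nat -> R).
  by apply: expbounded_shift; exact: expbounded_renewal_coef.
rewrite {1}renewal_coef_shift mlseriesD//; last exact: expboundedZ.
by rewrite mlseriesZ// mulN1r.
Qed.

(** Induction on [n]; the difference between the two sides solves the
    homogeneous Volterra equation. *)
Lemma renewal_prob_closed n t : pn n t = G (renewal_coef n) t.
Proof.
elim: n t => [|n IH] t; first exact: renewal_prob0.
have IH' : pn n = G (renewal_coef n) by apply/funext => u; exact: IH.
have p0 u : u < 0 -> pn n u = 0 by move=> u0; rewrite IH mlseries_lt0.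
have hr m : expbounded (renewal_coef m : nat -> R) by exact: expbounded_renewal_coef.
have [t0|t0] := ltP 0 t; last first.
  rewrite renewal_probS_le0//; move: t0; rewrite le_eqVlt => /predU1P[->|t0].
    by rewrite mlseries_renewal_coefS !mlseries_shift0// subrr.
  by rewrite mlseries_lt0.
have q0 u : u < 0 -> pn n.+1 u = 0 by move=> u0; rewrite renewal_probS_le0// ltW.
have pB m u : `|pn m u| <= 1 by rewrite ger0_norm ?renewal_prob_ge0// renewal_prob_le1.
have pE u : 0 < u -> pn n.+1 u = G (shift_seq (renewal_coef n)) u - fracint alpha (pn n.+1) u.
  move=> u0; have := partial_sum_split n.+1 u.
  rewrite !(renewal_equation alpha0 indX mlX) IH' convol_mlseries//.
  rewrite (@convol_fracint _ _ alpha0 (pn n.+1) 1)//; last exact: measurable_renewal_prob.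
  by rewrite -EFinD => /(congr1 fine)/= ->; rewrite addrK.
have [A [C [A0 C0 HB]]] := hr n.+1.
pose B := 1 + A * G (fun l => C ^+ l) t.
have gB u : u <= t -> `|G (renewal_coef n.+1) u| <= A * G (fun l => C ^+ l) t.
  by move=> ut; exact: mlseries_bound.
have AG0 : 0 <= A * G (fun l => C ^+ l) t by apply: (le_trans (normr_ge0 _) (gB t (lexx t))).
apply/eqP; rewrite -subr_eq0; apply/eqP.
apply: (@volterra_uniq _ _ alpha0 (fun u => pn n.+1 u - G (renewal_coef n.+1) u) B t) => //.
- by apply: measurable_funB; [exact: measurable_renewal_prob|exact: measurable_mlseries].
- by rewrite /B addr_ge0.
- move=> u /andP[u0 ut]; apply: (le_trans (ler_normB _ _)); rewrite /B lerD//.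
  exact: gB.
- move=> u /andP[u0 ut].
  rewrite (@fracintB _ _ B)//; last 5 first.
  + by rewrite /B addr_ge0.
  + exact: measurable_renewal_prob.
  + exact: measurable_mlseries.
  + by move=> v _; rewrite (le_trans (pB _ _))// /B lerDl.
  + move=> v /andP[_ vu]; apply: (le_trans (gB v _)); last by rewrite /B lerDr.
    by rewrite (le_trans (ltW vu)).
  rewrite fracint_mlseries// {1}pE// mlseries_renewal_coefS; ring.
- by rewrite t0 lexx.
Qed.

Lemma partial_sum_tail n t : (P [set w | (S n.+1 w <= t)%R] <=
   ((2 * G (fun l => (2 * 2) ^+ l) t) * 2^-1 ^+ n)%:E)%E.
Proof.
rewrite (renewal_equation alpha0 indX mlX) (_ : pn n = G (renewal_coef n)); last first.
  by apply/funext => u; exact: renewal_prob_closed.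
rewrite convol_mlseries//; last exact: expbounded_renewal_coef.
rewrite lee_fin; apply: (le_trans (ler_norm _)).
have W0 : 0 <= G (fun l => (2 * 2) ^+ l) t.
  apply: limr_ge.
    by apply: is_cvg_mlseries => //; apply: expbounded_exp; rewrite mulr_ge0.
  by apply: nearW => N; rewrite /series/= sumr_ge0// => l _; rewrite mulr_ge0 ?exprn_ge0 ?mlmon_ge0.
apply: (@le_trans _ _ (1 * G (fun l => (2 * 2) ^+ l) t / 2 ^+ n)).
  apply: mlseries_tail => //; rewrite ?ler1n//.
    case=> [|l] /=; first by rewrite normr0 expr0 mulr1.
    rewrite norm_renewal_coef mul1r; apply: (@le_trans _ _ ((1 + 1) ^+ l)).
      apply: le_trans (sum_bin_le n.+1 l (ler01 : 0 <= 1 :> R)).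
      rewrite big_ord_recr/= expr1n mul1r lerDr; apply: sumr_ge0 => i _.
      by rewrite mulr_ge0// exprn_ge0.
    by rewrite (_ : 1 + 1 = 2)// exprS ler_peMl ?exprn_ge0 ?ler1n.
  by case=> [//|l] ln /=; rewrite renewal_coef_small// ltnW.
rewrite -exprVn ler_wpM2r ?exprn_ge0 ?invr_ge0//.
by rewrite ler_wpM2r// ler1n.
Qed.

(** No explosion: [P(S_n <= t)] tends to 0 by [partial_sum_tail]. *)
Lemma ae_partial_sum_unbounded t : {ae P, forall w, exists n, t < S n w}.
Proof.
pose A := \bigcap_n [set w | S n.+1 w <= t].
have mA : measurable A by apply: bigcapT_measurable => n; exact: measurable_fun_le_set.
exists A; split => //; last first.
  move=> w /= H n _ /=; rewrite leNgt; apply/negP => tS; apply: H; by exists n.+1.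
apply/eqP; rewrite eq_le measure_ge0 andbT.
have AE : P A = (fine (P A))%:E by rewrite fineK// fin_num_measure.
rewrite AE lee_fin; apply/ler_addgt0Pr => e e0; rewrite add0r.
have [N /(_ N (leqnn N)) /ltW] := geometric_half_lt (2 * G (fun l => (2 * 2) ^+ l) t) e0.
apply: le_trans.
rewrite -lee_fin -AE; apply: le_trans (partial_sum_tail N t).
apply: le_measure; rewrite ?inE//; first exact: measurable_fun_le_set.
by move=> w; apply.
Qed.

End renewal_closed_form.

(** * The counting process *)

Section counting.
Context {R : realType} d {T : measurableType d} (P : probability T R).
Variables (alpha : R) (X : nat -> {RV P >-> R}).
Hypothesis alpha0 : 0 < alpha.
Hypothesis indX : mutually_independent X.
Hypothesis mlX : forall k, is_mittag_leffler_rv alpha 1 (X k).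
Local Notation S := (partial_sum X).
Local Notation N := (renewal_count (fun k => X k : T -> R)).

(** The count equals [m > 0] when the set of renewal indices is one of the
    countably many finite sets with [m] elements.  The value 0, also taken when
    there are infinitely many renewals, is the complementary case. *)
Lemma measurable_renewal_count t k : measurable [set w | N t w = k].
Proof.
have mk m : (0 < m)%N -> measurable [set w | N t w = m].
  move=> m0.
  (* [B i] is the event that the set of renewal indices is the finite set coded
     by [i], if that set has [m] elements; renewal [n] is at time [S n.+1]. *)
  pose B (i : nat) : set T := if @choice.unpickle {fset nat} i is Some J then
    if #|` J|%fset == m then \bigcap_n [set w | (S n.+1 w <= t) = (n \in J)] else set0
    else set0.
  have mB i : measurable (B i).
    rewrite /B; case: choice.unpickle => // J; case: ifP => // _.
    apply: bigcapT_measurable => n.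
    have mS := measurable_fun_le_set (f := S n.+1) t (measurable_funPT _).
    have [nJ|nJ] := boolP (n \in J); first exact: mS.
    rewrite (_ : [set _ | _] = ~` [set w | S n.+1 w <= t]); first exact: measurableC.
    by apply/seteqP; split=> w /= => [->//|/negP/negbTE].
  rewrite (_ : [set _ | _] = \bigcup_i B i); first exact: bigcupT_measurable.
  apply/seteqP; split=> w /=.
    rewrite /renewal_count => Nm.
    have [fA|fA] := pselect (finite_set [set n : nat | \sum_(k0 < n.+1) X k0 w <= t]); last first.
      by move: Nm; rewrite /fset_set; case: pselect => // _; rewrite cardfs0 => m0'; rewrite -m0' in m0.
    exists (choice.pickle (fset_set [set n : nat | \sum_(k0 < n.+1) X k0 w <= t])) => //.
    rewrite /B choice.pickleK Nm eqxx => n _ /=.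
    rewrite in_fset_set// partial_sumE.
    by apply/idP/idP => H; [rewrite inE|rewrite inE in H].
  move=> [i _]; rewrite /B; case: choice.unpickle => // J; case: ifP => // /eqP Jm H.
  rewrite /renewal_count -[RHS]Jm; congr (#|` _ |).
  rewrite -[RHS]set_fsetK; congr fset_set; apply/seteqP; split=> n /=.
    by rewrite -partial_sumE (H n).
  by rewrite -partial_sumE (H n).
case: k => [|k]; last exact: mk.
rewrite (_ : [set _ | _] = ~` \bigcup_m [set w | N t w = m.+1]).
  by apply: measurableC; apply: bigcupT_measurable => m; exact: mk.
apply/seteqP; split=> w /=; first by move=> N0 [m _ /=]; rewrite N0.
move=> H; apply: contrapT => N0; apply: H; exists (N t w).-1 => //=.
by rewrite prednK// lt0n; apply/eqP.
Qed.

Lemma partial_sum_mono w : (forall k, 0 < X k w) -> {homo (fun n => S n w) : m n / (m <= n)%N >-> m <= n}.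
Proof.
move=> X0 m n /subnK <-; elim: (n - m)%N => [//|i IH].
by rewrite addSn partial_sumS; apply: (le_trans IH); rewrite lerDl ltW.
Qed.

Lemma renewal_count_eq t w n : (forall k, 0 < X k w) ->
  S n w <= t < S n.+1 w -> N t w = n.
Proof.
move=> X0 /andP[Sn Sn1]; rewrite /renewal_count.
rewrite (_ : [set _ | _] = `I_n).
  by apply/(@card_fset_set _ `I_n n); rewrite card_eqxx.
apply/seteqP; split=> m /=; rewrite -partial_sumE.
  move=> Sm; rewrite ltnNge; apply/negP => nm.
  have := partial_sum_mono X0 (nm : (n.+1 <= m.+1)%N) => h.
  by have := lt_le_trans Sn1 (le_trans h Sm); rewrite ltxx.
by move=> mn; exact: le_trans (partial_sum_mono X0 mn) Sn.
Qed.

Lemma renewal_interval_exists t w : 0 <= t -> (exists n, t < S n w) ->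
  exists n, S n w <= t < S n.+1 w.
Proof.
move=> t0 ex; case: (ex_minnP ex) => -[|n] tn nmin.
  by move: tn; rewrite partial_sumE big_ord0 ltNge t0.
exists n; rewrite tn andbT leNgt; apply/negP => /nmin; by rewrite ltnn.
Qed.

Lemma prob_renewal_count t n : 0 <= t -> P [set w | N t w = n] = (renewal_prob X n t)%:E.
Proof.
move=> t0; rewrite EFin_renewal_prob; apply: ae_eq_prob.
- exact: measurable_renewal_count.
- exact: measurable_renewal_event.
have := ae_partial_sum_unbounded alpha0 indX mlX t.
have := ae_interarrival_gt0 mlX; apply: filterS2 => w X0 ex; split => /=; last exact: renewal_count_eq.
have [m Hm] := renewal_interval_exists t0 ex.
by rewrite (renewal_count_eq X0 Hm) => <-.
Qed.
End counting.

(** * The discrete queue *)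

Section queue.
Context {R : realType} d {T : measurableType d} (P : probability T R).

Lemma measurable_nat_RV (Y : {RV P >-> nat}) k : measurable [set w | Y w = k].
Proof. exact: (measurable_RV Y (A := [set k])). Qed.

Lemma total_prob (Y : {RV P >-> nat}) (A : set T) : measurable A ->
  (P A = \sum_(i <oo) P (A `&` [set w | Y w = i]))%E.
Proof.
move=> mA; rewrite -[in LHS](setIT A).
have -> : [set: T] = \bigcup_i [set w | Y w = i].
  by apply/seteqP; split=> w // _; exists (Y w).
rewrite setI_bigcupr measure_semi_bigcup//.
- by move=> i; apply: measurableI => //; exact: measurable_nat_RV.
- by move=> i j _ _ [w [[_ /= <-] [_ /= <-]]].
- by apply: bigcupT_measurable => i; apply: measurableI => //; exact: measurable_nat_RV.
Qed.

Variables (p : R) (Q : nat -> {RV P >-> nat}).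
Hypothesis p01 : 0 < p < 1.
Hypothesis markovQ : is_markov_chain (queue_transition p) Q.
Hypothesis emptyQ : started_empty Q.
Local Notation q := (queue_transition p).

Lemma queue_transition_ge0 i j : 0 <= q i j.
Proof.
have /andP[p0 p1] := p01.
by rewrite /queue_transition; case: ifP => _; [lra|case: ifP => _; lra].
Qed.

Definition cylinder (j n : nat) (x : nat -> nat) : set T :=
  [set w | forall k, (j <= k <= n)%N -> Q k w = x k].

Lemma measurable_cylinder j n x : measurable (cylinder j n x).
Proof.
rewrite (_ : cylinder j n x = \bigcap_k [set w | (j <= k <= n)%N -> Q k w = x k]); last first.
  by apply/seteqP; split=> w /= H k; [move=> _; exact: H|exact: (H k I)].
apply: bigcapT_measurable => k; have [jk|jk] := boolP (j <= k <= n)%N.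
  rewrite (_ : [set w | _] = [set w | Q k w = x k]); first exact: measurable_nat_RV.
  by apply/seteqP; split=> w /=; [exact|].
rewrite (_ : [set w | _] = setT)//.
by apply/seteqP; split=> w //= _.
Qed.

(** Summing over the possible values at time [j] forgets the past of the path,
    one step at a time. *)
Lemma markov_cylinder n j x : (j <= n)%N ->
  P (cylinder j n.+1 x) = (P (cylinder j n x) * (q (x n) (x n.+1))%:E)%E.
Proof.
elim: j x => [|j IH] x jn.
  have := markovQ n x; congr (P _ = P _ * _)%E.
(* Changing [x] at time [j] only, so that the induction hypothesis applies to
   each of the longer paths. *)
have split_ m : (j < m)%N -> P (cylinder j.+1 m x) =
    (\sum_(i <oo) P (cylinder j m (fun k => if k == j then i else x k)))%E.
  move=> jm; rewrite (total_prob (Q j)); last exact: measurable_cylinder.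
  apply: eq_eseriesr => i _; congr (P _); apply/seteqP; split=> w /=.
    move=> [H Qj] k /andP[jk km]; case: eqP => [->//|/eqP kj].
    by apply: H; rewrite km andbT ltn_neqAle eq_sym kj.
  move=> H; split.
    move=> k /andP[jk km]; have := H k; rewrite gtn_eqF//.
    by apply; rewrite km (ltnW jk).
  by have := H j; rewrite eqxx leqnn (ltnW jm); exact.
rewrite split_; last by rewrite ltnS ltnW.
rewrite split_// muleC -nneseriesZl//.
apply: eq_eseriesr => i _; rewrite IH ?(ltnW jn)// muleC.
by rewrite gtn_eqF// gtn_eqF// ltnS ltnW.
Qed.

Definition queue_law (n k : nat) : R := fine (P [set w | Q n w = k]).

Lemma EFin_queue_law n k : (queue_law n k)%:E = P [set w | Q n w = k].
Proof. by rewrite fineK// fin_num_measure//; exact: measurable_nat_RV. Qed.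

Lemma queue_law_ge0 n k : 0 <= queue_law n k.
Proof. exact: fine_ge0. Qed.

Lemma queue_law_step n k : ((queue_law n.+1 k)%:E =
  \sum_(i <oo) (queue_law n i * q i k)%:E)%E.
Proof.
rewrite EFin_queue_law (total_prob (Q n)); last exact: measurable_nat_RV.
apply: eq_eseriesr => i _.
have := @markov_cylinder n n (fun m => if m == n then i else k) (leqnn n).
rewrite eqxx gtn_eqF// EFinM EFin_queue_law; congr (P _ = P _ * _)%E; apply/seteqP; split=> w /=.
- move=> H; split; first by have := H n.+1; rewrite gtn_eqF// leqnSn leqnn; exact.
  by have := H n; rewrite eqxx leqnSn leqnn; exact.
- move=> [H1 H2] m /andP[nm mn]; case: eqP => [->//|/eqP mn'].
  suff -> : m = n.+1 by [].
  by apply/eqP; rewrite eqn_leq mn/= ltn_neqAle eq_sym mn'.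
- by move=> H; have := H n; rewrite eqxx leqnn; exact.
- by move=> H m; rewrite -eqn_leq => /eqP<-; rewrite eqxx.
Qed.

Lemma queue_law0 k : queue_law 0 k = (k == 0)%N%:R.
Proof.
apply: EFin_inj; rewrite EFin_queue_law.
have [->|k0] := eqVneq k 0%N.
  rewrite -(@probability_setT _ _ _ P); apply: ae_eq_prob => //; first exact: measurable_nat_RV.
  by move: emptyQ; apply: filterS => w Q0; split.
transitivity (P set0); last exact: measure0.
apply: ae_eq_prob => //; first exact: measurable_nat_RV.
by move: emptyQ; apply: filterS => w Q0; split => //=; rewrite Q0 => k0'; rewrite -k0' in k0.
Qed.

(** The queue starts empty and grows by at most one unit at each step. *)
Lemma queue_law_gt n k : (n < k)%N -> queue_law n k = 0.
Proof.
elim: n k => [|n IH] k nk; first by rewrite queue_law0 gtn_eqF.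
apply: EFin_inj; rewrite queue_law_step; apply: eseries0 => i _ _.
have [ni|ni] := ltnP n i; first by rewrite IH// mul0r.
rewrite /queue_transition gtn_eqF ?(leq_ltn_trans _ nk)// gtn_eqF ?mulr0//.
by apply: leq_ltn_trans nk; apply: (leq_trans (leq_pred _)); exact: leqW.
Qed.

Lemma queue_law_stepE n k : queue_law n.+1 k = \sum_(i < n.+1) queue_law n i * q i k.
Proof.
apply: EFin_inj; rewrite queue_law_step (nneseries_split 0 n.+1); last first.
  by move=> i _; rewrite lee_fin mulr_ge0 ?queue_law_ge0 ?queue_transition_ge0.
rewrite [X in (_ + X)%E]eseries0 ?adde0; last first.
  by move=> i; rewrite add0n => ni _; rewrite queue_law_gt// mul0r.
by rewrite add0n big_mkord sumEFin.
Qed.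

(** The expectation of [f (Q n)]; a finite sum because [Q n <= n] almost
    surely. *)
Definition queue_mean (f : nat -> R) (n : nat) : R := \sum_(k < n.+1) f k * queue_law n k.

Lemma queue_meanS f n : queue_mean f n.+1 =
  \sum_(i < n.+1) (p * f i.+1 + (1 - p) * f i.-1) * queue_law n i.
Proof.
rewrite /queue_mean.
under eq_bigr do rewrite queue_law_stepE mulr_sumr.
rewrite exchange_big/=; apply: eq_bigr => i _.
have i2 : (i.+1 < n.+2)%N by rewrite ltnS ltn_ord.
have i1 : (i.-1 < n.+2)%N by apply: (leq_ltn_trans (leq_pred i)); exact: (ltnW (ltn_ord i)).
have i12 : Ordinal i1 != Ordinal i2 by rewrite -val_eqE/= ltn_eqF// ltnS leq_pred.
rewrite (bigD1 (Ordinal i2))//= (bigD1 (Ordinal i1))//= big1 ?addr0; last first.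
  move=> j /andP[j2 j1]; rewrite /queue_transition.
  rewrite !ifN ?mulr0//.
rewrite /queue_transition !eqxx ifN//; ring.
Qed.

Lemma queue_mean1 n : queue_mean (fun=> 1) n = 1.
Proof.
elim: n => [|n IH]; first by rewrite /queue_mean big_ord1 queue_law0 mulr1.
rewrite queue_meanS -[RHS]IH /queue_mean; apply: eq_bigr => i _; ring.
Qed.

Lemma queue_mean_le f C n : (forall k, (k <= n)%N -> `|f k| <= C) -> `|queue_mean f n| <= C.
Proof.
move=> fC; rewrite -[leRHS]mulr1 -(queue_mean1 n) /queue_mean mulr_sumr.
apply: (le_trans (ler_norm_sum _ _ _)); apply: ler_sum => k _.
rewrite normrM mul1r (ger0_norm (queue_law_ge0 _ _)).
by rewrite ler_wpM2r ?queue_law_ge0// fC// -ltnS.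
Qed.

Lemma ae_queue_le : {ae P, forall w, forall n, (Q n w <= n)%N}.
Proof.
have : {ae P, forall w, forall n, forall k, (n < k)%N -> Q n w <> k}.
  apply: ae_forall_nat => n; apply: ae_forall_nat => k.
  have [nk|nk] := ltnP n k; last by apply: aeW => w.
  exists [set w | Q n w = k]; split; first exact: measurable_nat_RV.
    by apply/eqP; rewrite -EFin_queue_law queue_law_gt.
  by move=> w /= H; apply: contrapT => Qk; apply: H.
apply: filterS => w H n; rewrite leqNgt; apply/negP => /H; exact.
Qed.
End queue.

(** * Expectations of the time-changed queue *)

Section expectation.
Context {R : realType} d {T : measurableType d} (P : probability T R).
Variables (alpha p : R) (X : nat -> {RV P >-> R}) (Q : nat -> {RV P >-> nat}).
Hypothesis alpha0 : 0 < alpha.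
Hypothesis hqueue : is_fractional_queue_data alpha 1 p X Q.
Hypothesis emptyQ : started_empty Q.
Local Notation N := (renewal_count (fun k => X k : T -> R)).
Local Notation L := (time_changed X Q).
Local Notation G := (mlseries alpha).

Let indX : mutually_independent X. Proof. by case: hqueue. Qed.
Let mlX : forall k, is_mittag_leffler_rv alpha 1 (X k). Proof. by case: hqueue. Qed.
Let markovQ : is_markov_chain (queue_transition p) Q. Proof. by case: hqueue. Qed.

Lemma queue_count_indep t n k : 0 <= t ->
  P ([set w | Q n w = k] `&` [set w | N t w = n]) =
  (queue_law Q n k * renewal_prob X n t)%:E.
Proof.
move=> t0; rewrite EFinM EFin_queue_law -(prob_renewal_count alpha0 indX mlX)//.
have [_ _ _] := hqueue; apply; apply: sub_sigma_algebra.
  by exists n => //; exists [set k] => //; rewrite setTI.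
by exists t => //; exists [set n] => //; rewrite setTI.
Qed.

Lemma measurable_time_changed t : measurable_fun setT (L t).
Proof.
move=> _ B mB; rewrite setTI.
rewrite (_ : _ @^-1` B = \bigcup_n ([set w | N t w = n] `&` Q n @^-1` B)).
  apply: bigcupT_measurable => n; apply: measurableI.
    exact: measurable_renewal_count.
  exact: measurable_RV.
apply/seteqP; split=> w /=; first by exists (N t w).
by move=> [n _ [/= <-]].
Qed.

Lemma measurable_time_changed_fun (f : nat -> R) t : measurable_fun setT (fun w => f (L t w)).
Proof.
apply: (@measurableT_comp _ _ _ _ _ _ f _ (L t)); last exact: measurable_time_changed.
by move=> _ B mB.
Qed.

(** Splitting according to the value [n] of the count; on that event the queue
    is [Q n], which is independent of the count. *)
Lemma integral_time_changed (f : nat -> R) t : 0 <= t -> (forall k, 0 <= f k) ->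
  (\int[P]_w (f (L t w))%:E = \sum_(n <oo) (queue_mean Q f n * renewal_prob X n t)%:E)%E.
Proof.
move=> t0 f0.
have mN n : measurable [set w | N t w = n] by exact: measurable_renewal_count.
have TE : [set: T] = \bigcup_n [set w | N t w = n].
  by apply/seteqP; split=> w // _; exists (N t w).
have mf : measurable_fun setT (fun w => (f (L t w))%:E).
  by apply/measurable_EFinP; exact: measurable_time_changed_fun.
rewrite TE ge0_integral_bigcup//; last 3 first.
- by rewrite -TE.
- by move=> w _; rewrite lee_fin.
- by move=> i j _ _ [w [/= <- <-]].
apply: eq_eseriesr => n _.
have mg k : measurable_fun setT (fun w => (f k)%:E * (\1_[set w | Q n w = k] w)%:E : \bar R)%E.
  apply: emeasurable_funM => //; apply/measurable_EFinP; apply: measurable_indic.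
  exact: measurable_nat_RV.
transitivity (\int[P]_(w in [set w | N t w = n])
    (\sum_(k <- index_iota 0 n.+1) (f k)%:E * (\1_[set w | Q n w = k] w)%:E))%E.
  apply: ae_eq_integral => //.
  - exact: measurable_funTS.
  - by apply: emeasurable_sum => k; exact: measurable_funTS.
  - have := ae_queue_le markovQ emptyQ; apply: filterS => w Qn Nn.
    rewrite /time_changed; move: Nn => /= ->.
    rewrite (bigD1_seq (Q n w)) ?mem_index_iota ?iota_uniq ?ltnS ?Qn//=.
    rewrite indicE mem_set//= mule1 big1 ?adde0// => k kQ.
    by rewrite indicE memNset ?mule0//= => QE; rewrite QE eqxx in kQ.
rewrite ge0_integral_sum//; last 2 first.
- by move=> k; exact: measurable_funTS.
- by move=> k w _; rewrite mule_ge0// lee_fin.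
rewrite /queue_mean mulr_suml -sumEFin big_mkord; apply: eq_bigr => k _.
rewrite ge0_integralZl ?lee_fin//; last first.
  by apply/measurable_EFinP; apply: measurable_indic; exact: measurable_nat_RV.
rewrite integral_indic//; last exact: measurable_nat_RV.
transitivity ((f k)%:E * (queue_law Q n k * renewal_prob X n t)%:E)%E.
  by congr (_ * _)%E; exact: queue_count_indep.
by rewrite -EFinM mulrA.
Qed.

Lemma expectation_time_changed (f : nat -> R) C t : 0 <= t -> (forall k, 0 <= f k) ->
  0 <= C -> (forall n, `|queue_mean Q f n| <= C ^+ n) ->
  (\int[P]_w (f (L t w))%:E = (G (fdiff (queue_mean Q f)) t)%:E)%E.
Proof.
move=> t0 f0 C0 fC; rewrite integral_time_changed//.
apply: cvg_lim => //.
rewrite [X in X @ _](_ : _ =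
    (fun K => (series (fun n => queue_mean Q f n * G (renewal_coef n) t) K)%:E)); last first.
  apply/funext => K /=; rewrite -sumEFin; apply: eq_bigr => k _.
  by rewrite (renewal_prob_closed alpha0 indX mlX).
by apply: cvg_EFin; [exact: nearW|exact: newton_series C0 fC].
Qed.

End expectation.

(** * The fractional differential equation *)

Section fractional_equation.
Context {R : realType} d {T : measurableType d} (P : probability T R).
Variables (alpha p : R) (X : nat -> {RV P >-> R}) (Q : nat -> {RV P >-> nat}).
Hypothesis alpha0 : 0 < alpha.
Hypothesis p01 : 0 < p < 1.
Hypothesis hqueue : is_fractional_queue_data alpha 1 p X Q.
Hypothesis emptyQ : started_empty Q.
Local Notation L := (time_changed X Q).
Local Notation G := (mlseries alpha).

Let markovQ : is_markov_chain (queue_transition p) Q. Proof. by case: hqueue. Qed.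

Definition queue_mgf (z : R) : nat -> R := queue_mean Q (fun k => expR (z * k%:R)).
Definition queue_empty (n : nat) : R := queue_law Q n 0.
Definition mgf_coef (z : R) : nat -> R := fdiff (queue_mgf z).
Definition empty_coef : nat -> R := fdiff queue_empty.
Definition drift (z : R) : R := p * expR z - 1 + (1 - p) * expR (- z).
Definition boundary_rate (z : R) : R := (1 - p) * (1 - expR (- z)).

Lemma queue_mgf_le z n : `|queue_mgf z n| <= expR `|z| ^+ n.
Proof.
apply: (queue_mean_le p01 markovQ emptyQ) => k kn.
rewrite ger0_norm ?expR_ge0// mulrC expRM_natl.
apply: (@le_trans _ _ (expR `|z| ^+ k)).
  by apply: lerXn2r; rewrite ?nnegrE ?expR_ge0// ler_expR ler_norm.
by apply: ler_weXn2l => //; rewrite -expR0 ler_expR.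
Qed.

Lemma queue_empty_mean : queue_empty = queue_mean Q (fun k => (k == 0)%N%:R).
Proof.
apply/funext => n; rewrite /queue_mean big_ord_recl/= mul1r big1 ?addr0// => i _.
by rewrite mul0r.
Qed.

Lemma queue_empty_le n : `|queue_empty n| <= 1 ^+ n.
Proof.
rewrite expr1n queue_empty_mean; apply: (queue_mean_le p01 markovQ emptyQ) => k _.
by case: eqP; rewrite ?normr1 ?normr0.
Qed.

Lemma expbounded_mgf_coef z : expbounded (mgf_coef z).
Proof. exact: expbounded_fdiff (expR_ge0 _) (queue_mgf_le z). Qed.

Lemma expbounded_empty_coef : expbounded empty_coef.
Proof. exact: expbounded_fdiff ler01 queue_empty_le. Qed.

(** At [k = 0] the step down is replaced by staying in place, which contributes
    the boundary term. *)
Lemma queue_mgfS z n : queue_mgf z n.+1 - queue_mgf z n =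
  drift z * queue_mgf z n + boundary_rate z * queue_empty n.
Proof.
rewrite /queue_mgf (queue_meanS p01 markovQ emptyQ) queue_empty_mean /queue_mean.
rewrite -sumrB !mulr_sumr -big_split/=; apply: eq_bigr => i _.
rewrite /drift /boundary_rate; set a := queue_law _ _ _.
case: (nat_of_ord i) => [|k]/=.
  by rewrite mulr1 mulr0 expR0; ring.
rewrite -natr1 -[in k.+1%:R]natr1 !mulrDr !expRD !mulr1.
have e0 : expR (- z) * expR z = 1 by rewrite -expRD addNr expR0.
transitivity ((p * (expR (z * k%:R) * expR z * expR z) + (1 - p) * (expR (- z) * expR z) * expR (z * k%:R) -
  expR (z * k%:R) * expR z) * a); first by rewrite e0; ring.
by ring.
Qed.

Lemma mgf_coefS z l : mgf_coef z l.+1 = drift z * mgf_coef z l + boundary_rate z * empty_coef l.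
Proof.
rewrite /mgf_coef fdiffS -!fdiffZ -fdiffD; congr (fdiff _ l).
by apply/funext => n; exact: queue_mgfS.
Qed.

Lemma mgf_coef0 z : mgf_coef z 0 = 1.
Proof.
rewrite /mgf_coef fdiff0 /queue_mgf /queue_mean big_ord1 mulr0 expR0 mul1r.
by rewrite (queue_law0 emptyQ).
Qed.

Lemma expectation_mgf z t : 0 <= t ->
  (\int[P]_w (expR (z * (L t w)%:R))%:E = (G (mgf_coef z) t)%:E)%E.
Proof.
move=> t0; apply: (expectation_time_changed alpha0 hqueue emptyQ
  (f := fun k => expR (z * k%:R)) t0 _ (expR_ge0 `|z|) (queue_mgf_le z)).
by move=> k; exact: expR_ge0.
Qed.

Lemma mgfE z t : 0 <= t -> mgf P L z t = G (mgf_coef z) t.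
Proof. by move=> t0; rewrite /mgf unlock expectation_mgf. Qed.

Lemma prob_emptyE t : 0 <= t -> prob_empty P L t = G empty_coef t.
Proof.
move=> t0; rewrite /prob_empty.
have mE : measurable [set w | L t w = 0%N].
  have mL := measurable_time_changed X Q t.
  by have := mL measurableT [set 0%N] I; rewrite setTI.
have -> : (P [set w | L t w = 0%N] = \int[P]_w ((L t w == 0)%N%:R)%:E)%E.
  rewrite -[in LHS](setIT [set w | L t w = 0%N]) -integral_indic//.
  apply: eq_integral => w _; rewrite indicE; congr ((nat_of_bool _)%:R)%:E.
  by apply/idP/idP; rewrite inE/= => /eqP.
rewrite (@expectation_time_changed _ _ _ _ _ _ _ _ alpha0 hqueue emptyQ
  (fun k => (k == 0)%N%:R) 1 t t0)//=.
  by rewrite -queue_empty_mean.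
by rewrite -queue_empty_mean; exact: queue_empty_le.
Qed.

Lemma integrable_mgf z t : 0 <= t ->
  P.-integrable setT (fun w => (expR (z * (L t w)%:R))%:E).
Proof.
move=> t0; apply/integrableP; split.
  apply/measurable_EFinP.
  exact: (measurable_time_changed_fun X Q (fun k => expR (z * k%:R))).
under eq_integral.
  move=> w _; rewrite gee0_abs; last by rewrite lee_fin expR_ge0.
  over.
by rewrite expectation_mgf// ltry.
Qed.

Lemma caputo_mgf z t : alpha <= 1 -> 0 < t ->
  is_caputo_derive alpha (mgf P L z) t
    (boundary_rate z * prob_empty P L t + drift z * mgf P L z t).
Proof.
move=> a1 t0.
rewrite prob_emptyE ?ltW// mgfE ?ltW//.
have hb := expbounded_mgf_coef z; have hc := expbounded_empty_coef.
rewrite addrC -!mlseriesZ// -mlseriesD//; [|exact: expboundedZ|exact: expboundedZ].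
rewrite (_ : (fun l => _) = (fun l => mgf_coef z l.+1)); last first.
  by apply/funext => l; rewrite mgf_coefS.
by apply: caputo_mlseries => // u u0; rewrite mgfE// ltW.
Qed.
End fractional_equation.

(** * The roots of the characteristic polynomial *)

Section characteristic_roots.
Context {R : realType}.
Variables (alpha p s : R).
Hypothesis p01 : 0 < p < 1.
Hypothesis s0 : 0 < s.
Local Notation sa := (s `^ alpha).
Local Notation r1 := (r1 alpha p s).
Local Notation r2 := (r2 alpha p s).

Lemma discriminant_gt0 : 0 < (1 + sa) ^+ 2 - 4 * p * (1 - p).
Proof.
have a0 : 0 < sa by exact: powR_gt0.
have h : 0 <= (1 - 2 * p) ^+ 2 by exact: sqr_ge0.
have h2 : 0 < sa * sa by rewrite mulr_gt0.
by rewrite !expr2 in h *; nra.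
Qed.

(** This quadratic in [x = e^z] is [(kappa - s ^ alpha) e^z]. *)
Lemma char_poly_factor x :
  p * x ^+ 2 - (1 + sa) * x + (1 - p) = p * (x - r1) * (x - r2).
Proof.
have /andP[p0 p1] := p01.
have := sqr_sqrtr (ltW discriminant_gt0).
rewrite /Defs.r1 /Defs.r2; set q := Num.sqrt _ => q2.
have E : p * (x - (1 + sa + q) / (2 * p)) * (x - (1 + sa - q) / (2 * p)) =
  p * x ^+ 2 - (1 + sa) * x + ((1 + sa) ^+ 2 - q ^+ 2) / (4 * p).
  by field; rewrite gt_eqF.
by rewrite E q2; field; rewrite gt_eqF.
Qed.

Lemma r2_lt_r1 : r2 < r1.
Proof.
have /andP[p0 p1] := p01.
rewrite /Defs.r1 /Defs.r2 ltr_pM2r ?invr_gt0 ?mulr_gt0//.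
have : 0 < Num.sqrt ((1 + sa) ^+ 2 - 4 * p * (1 - p)) by rewrite sqrtr_gt0 discriminant_gt0.
lra.
Qed.

(** At [x = 1] the quadratic equals [- s ^ alpha < 0], so 1 lies strictly
    between the roots, and their product [(1 - p) / p] is positive. *)
Lemma char_roots_order : [/\ 0 < r2, r2 < 1 & 1 < r1].
Proof.
have /andP[p0 p1] := p01.
have a0 : 0 < sa by exact: powR_gt0.
have r21 := r2_lt_r1.
have f1 : (1 - r1) * (1 - r2) < 0.
  have := char_poly_factor 1; rewrite expr1n mulr1 => H.
  have : p * ((1 - r1) * (1 - r2)) < 0 by rewrite mulrA -H; lra.
  by rewrite pmulr_rlt0.
have f0 : 0 < r1 * r2.
  have := char_poly_factor 0; rewrite expr0n/= mulr0 => H.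
  have : 0 < p * (r1 * r2) by rewrite (_ : p * (r1 * r2) = p * (0 - r1) * (0 - r2)); [rewrite -H; lra|ring].
  by rewrite pmulr_rgt0.
have h1 : r2 < 1 by rewrite ltNge; apply/negP => h; nra.
have h2 : 1 < r1 by rewrite ltNge; apply/negP => h; nra.
split=> //; rewrite ltNge; apply/negP => h; nra.
Qed.

Lemma drift_factor z : (s `^ alpha - drift p z) * expR z = - (p * (expR z - r1) * (expR z - r2)).
Proof.
rewrite -char_poly_factor /drift.
have e0 : expR (- z) * expR z = 1 by rewrite -expRD addNr expR0.
transitivity ((1 + sa) * expR z - p * expR z ^+ 2 - (1 - p) * (expR (- z) * expR z)); first by ring.
by rewrite e0; ring.
Qed.
End characteristic_roots.

(** * Laplace transforms *)

(** One-sided passage to the limit [e -> 0] in a bound that holds for small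
    [e > 0]; it replaces continuity in the squeeze of [laplace_mgf_at_r2]. *)
Lemma le_of_lt_shift (R : realFieldType) (V g c e0 : R) : 0 <= V -> 0 < e0 ->
  (forall e, 0 < e < e0 -> V * (g - e) <= c) -> V * g <= c.
Proof.
move=> V0 e00 H; rewrite leNgt; apply/negP => cV.
have V1 : 0 < 2 * (V + 1) by lra.
(* So small that [V * e] stays below half of the gap [V * g - c]. *)
pose e := Num.min (e0 / 2) ((V * g - c) / (2 * (V + 1))).
have d0 : 0 < (V * g - c) / (2 * (V + 1)) by rewrite divr_gt0// subr_gt0.
have e_gt0 : 0 < e by rewrite lt_min d0 andbT; lra.
have e1 : e < e0 by rewrite gt_min; apply/orP; left; lra.
have := H e; rewrite e_gt0 e1 => /(_ isT) h.
have e2 : e <= (V * g - c) / (2 * (V + 1)) by rewrite ge_min lexx orbT.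
rewrite ler_pdivlMr// in e2; nra.
Qed.

Lemma ge_of_lt_shift (R : realFieldType) (V g c e0 : R) : 0 <= V -> 0 < e0 ->
  (forall e, 0 < e < e0 -> c <= V * (g + e)) -> c <= V * g.
Proof.
move=> V0 e00 H; rewrite -lerN2 -mulrN; apply: (le_of_lt_shift V0 e00) => e he.
by rewrite -opprD mulrN lerN2; exact: H.
Qed.

Section laplace_mlseries.
Context {R : realType}.
Local Notation mu := (@lebesgue_measure R).
Variables (alpha s : R).
Hypothesis alpha0 : 0 < alpha.
Hypothesis s0 : 0 < s.
Local Notation G := (mlseries alpha).

Definition laplace_integrable (f : R -> R) :=
  mu.-integrable setT (EFin \o (fun t => expR (- s * t) * f t)).

Definition laplaceR (f : R -> R) : R := \int[mu]_t (expR (- s * t) * f t).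

Lemma laplaceE_laplaceR f : laplace_integrable f -> laplaceE s f = (laplaceR f)%:E.
Proof.
by move=> intf; rewrite /laplaceR /Rintegral fineK//; exact: integrable_fin_num.
Qed.

Lemma measurable_laplace (f : R -> R) : measurable_fun [set: R] f ->
  measurable_fun [set: R] (fun t => expR (- s * t) * f t).
Proof. by move=> mf; apply: measurable_funM => //; exact: measurable_expM. Qed.

Lemma ge0_laplace_integrable (f : R -> R) : measurable_fun [set: R] f -> (forall t, 0 <= f t) ->
  (laplaceE s f < +oo)%E -> laplace_integrable f.
Proof.
move=> mf f0 fin; apply/integrableP; split.
  by apply/measurable_EFinP; exact: measurable_laplace.
under eq_integral.
  move=> t _; rewrite /= ger0_norm; last by rewrite mulr_ge0 ?expR_ge0.
  over.
exact: fin.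
Qed.

Lemma laplace_integrable_rlker1 : laplace_integrable (rlker 1).
Proof.
apply: ge0_laplace_integrable.
- exact: measurable_rlker.
- by move=> t; exact: rlker_ge0.
- by rewrite laplaceE_rlker// ltry.
Qed.

Lemma laplaceR_rlker1 : laplaceR (rlker 1) = s^-1.
Proof.
apply: EFin_inj; rewrite -laplaceE_laplaceR ?laplaceE_rlker//; last exact: laplace_integrable_rlker1.
by rewrite powR_inv1// ltW.
Qed.

Lemma bounded_laplace_integrable (f : R -> R) : measurable_fun [set: R] f ->
  (forall t, `|f t| <= rlker 1 t) -> laplace_integrable f.
Proof.
move=> mf fle; apply: le_integrable laplace_integrable_rlker1 => //.
  by apply/measurable_EFinP; exact: measurable_laplace.
move=> t _ /=; rewrite lee_fin !normrM ler_wpM2l// (ger0_norm (rlker_ge0 _ _))//.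
Qed.

Lemma laplaceRD (f g : R -> R) : laplace_integrable f -> laplace_integrable g ->
  laplace_integrable (fun t => f t + g t) /\
  laplaceR (fun t => f t + g t) = laplaceR f + laplaceR g.
Proof.
move=> intf intg.
have E : (fun t => expR (- s * t) * (f t + g t)) =
    (fun t => expR (- s * t) * f t + expR (- s * t) * g t).
  by apply/funext => t; rewrite mulrDr.
split; first by rewrite /laplace_integrable E; exact: integrable_addr.
by rewrite /laplaceR E RintegralD.
Qed.

Lemma laplaceRZ (k : R) (f : R -> R) : laplace_integrable f ->
  laplace_integrable (fun t => k * f t) /\ laplaceR (fun t => k * f t) = k * laplaceR f.
Proof.
move=> intf.
have E : (fun t => expR (- s * t) * (k * f t)) = (fun t => k * (expR (- s * t) * f t)).
  by apply/funext => t; rewrite mulrCA.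
split; first by rewrite /laplace_integrable E; exact: integrable_mull.
by rewrite /laplaceR E RintegralZl.
Qed.

Lemma laplace_shift b : expbounded b -> (forall t, 0 <= G b t) -> laplace_integrable (G b) ->
  laplace_integrable (G (shift_seq b)) /\
  laplaceR (G (shift_seq b)) = s `^ (- alpha) * laplaceR (G b).
Proof.
move=> hb b0 intb.
have mb : measurable_fun [set: R] (G b) by exact: measurable_mlseries.
have hs := expbounded_shift hb.
have s_ge0 t : 0 <= G (shift_seq b) t.
  rewrite -lee_fin -convol_mlseries//; apply: integral_ge0 => u _.
  by rewrite lee_fin mulr_ge0 ?rlker_ge0.
have E : laplaceE s (G (shift_seq b)) = (s `^ (- alpha) * laplaceR (G b))%:E.
  rewrite EFinM -laplaceE_laplaceR// -laplaceE_rlker//.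
  rewrite -laplace_convol//; [|exact: measurable_rlker|by move=> t; exact: rlker_ge0].
  by apply: eq_integral => t _; rewrite convol_mlseries// EFinM.
have ints : laplace_integrable (G (shift_seq b)).
  apply: ge0_laplace_integrable => //; first exact: measurable_mlseries.
  by rewrite E ltry.
by split=> //; apply: EFin_inj; rewrite -laplaceE_laplaceR.
Qed.

(** The recursion says [G b = 1 + k (K_alpha * G b) + a (K_alpha * G c)];
    taking transforms and multiplying by [s ^ alpha] gives the claim. *)
Lemma laplace_combination (b c : nat -> R) (k a : R) : expbounded b -> expbounded c ->
  (forall t, 0 <= G b t) -> (forall t, 0 <= G c t) ->
  laplace_integrable (G b) -> laplace_integrable (G c) ->
  b 0%N = 1 -> (forall l, b l.+1 = k * b l + a * c l) ->
  (s `^ alpha - k) * laplaceR (G b) = s `^ (alpha - 1) + a * laplaceR (G c).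
Proof.
move=> hb hc b0 c0 intb intc bz bS.
have [ib Eb] := laplace_shift hb b0 intb.
have [ic Ec] := laplace_shift hc c0 intc.
have hsb := expbounded_shift hb; have hsc := expbounded_shift hc.
have GE t : G b t = rlker 1 t + (k * G (shift_seq b) t + a * G (shift_seq c) t).
  transitivity (G (fun l => deltaseq l + (k * shift_seq b l + a * shift_seq c l)) t).
    congr (G _ t); apply/funext => -[|l]; first by rewrite bz /deltaseq /= !mulr0 !addr0.
    by rewrite bS /deltaseq/= add0r.
  rewrite mlseriesD//; [|exact: expbounded_deltaseq|by apply: expboundedD; exact: expboundedZ].
  rewrite mlseries_delta -rlker1 mlseriesD//; [|exact: expboundedZ|exact: expboundedZ].
  by rewrite !mlseriesZ.
have [ikb Ekb] := laplaceRZ k ib; have [iac Eac] := laplaceRZ a ic.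
have [ibc Ebc] := laplaceRD ikb iac.
have [_ Eall] := laplaceRD laplace_integrable_rlker1 ibc.
have M : laplaceR (G b) = s^-1 + (k * (s `^ (- alpha) * laplaceR (G b)) +
    a * (s `^ (- alpha) * laplaceR (G c))).
  by rewrite -Ec -Eb -Ekb -Eac -Ebc -laplaceR_rlker1 -Eall; congr laplaceR; apply/funext.
have sn (x : bool) : x ==> (s != 0) by rewrite (gt_eqF s0) implybT.
have e1 : s `^ alpha * s `^ (- alpha) = 1 by rewrite -powRD// subrr powRr0.
have e2 : s `^ (alpha - 1) = s `^ alpha * s^-1 by rewrite powRD// powR_inv1// ltW.
rewrite mulrBl {1}M e2; move: e1; set u := s `^ alpha; set v := s `^ (- alpha) => e1.
transitivity (u * s^-1 + (k * (u * v * laplaceR (G b)) +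
    a * (u * v * laplaceR (G c))) - k * laplaceR (G b)); first by ring.
by rewrite e1; ring.
Qed.
End laplace_mlseries.

(** * The Laplace transform of the moment generating function *)

Section laplace_mgf.
Context {R : realType} d {T : measurableType d} (P : probability T R).
Local Notation mu := (@lebesgue_measure R).
Variables (alpha p : R) (X : nat -> {RV P >-> R}) (Q : nat -> {RV P >-> nat}).
Hypothesis alpha0 : 0 < alpha.
Hypothesis p01 : 0 < p < 1.
Hypothesis hqueue : is_fractional_queue_data alpha 1 p X Q.
Hypothesis emptyQ : started_empty Q.
Variable s : R.
Hypothesis s0 : 0 < s.
Local Notation L := (time_changed X Q).
Local Notation G := (mlseries alpha).
Local Notation Gm z := (G (mgf_coef Q z)).
Local Notation Ge := (G (empty_coef Q)).
Local Notation r1 := (r1 alpha p s).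
Local Notation r2 := (r2 alpha p s).
Local Notation lap := (laplaceR s).
Local Notation tau := (s `^ (alpha - 1)).

Let hm z : expbounded (mgf_coef Q z).
Proof. exact: (expbounded_mgf_coef p01 hqueue emptyQ). Qed.

Let he : expbounded (empty_coef Q).
Proof. exact: (expbounded_empty_coef p01 hqueue emptyQ). Qed.

Lemma mgf_mlseries_ge0 z t : 0 <= Gm z t.
Proof.
have [t0|t0] := leP 0 t; last by rewrite mlseries_lt0.
rewrite -lee_fin -(expectation_mgf alpha0 p01 hqueue emptyQ z t0).
by apply: integral_ge0 => w _; rewrite lee_fin expR_ge0.
Qed.

Lemma mgf_mlseries_le z z' t : z <= z' -> Gm z t <= Gm z' t.
Proof.
move=> zz'; have [t0|t0] := leP 0 t; last by rewrite !mlseries_lt0.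
rewrite -lee_fin -!(expectation_mgf alpha0 p01 hqueue emptyQ _ t0).
apply: ge0_le_integral => //.
- apply/measurable_EFinP.
  exact: (measurable_time_changed_fun X Q (fun k => expR (z * k%:R))).
- apply/measurable_EFinP.
  exact: (measurable_time_changed_fun X Q (fun k => expR (z' * k%:R))).
- by move=> w _; rewrite lee_fin ler_expR ler_wpM2r.
Qed.

Lemma mgf_mlseries_le_rlker1 z t : z <= 0 -> Gm z t <= rlker 1 t.
Proof.
move=> z0; have [t0|t0] := leP 0 t; last by rewrite mlseries_lt0// rlker_ge0.
apply: (le_trans (mgf_mlseries_le t z0)); rewrite rlker1 t0.
rewrite -lee_fin -(expectation_mgf alpha0 p01 hqueue emptyQ 0 t0).
under eq_integral do rewrite mul0r expR0.
by rewrite integral_cst// mul1e; exact: probability_le1.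
Qed.

Lemma empty_mlseries_bounds t : 0 <= Ge t <= rlker 1 t.
Proof.
have [t0|t0] := leP 0 t; last by rewrite mlseries_lt0// lexx rlker_ge0.
have mE : measurable [set w | L t w = 0%N].
  have mL := measurable_time_changed X Q t.
  by have := mL measurableT [set 0%N] I; rewrite setTI.
rewrite -(prob_emptyE alpha0 p01 hqueue emptyQ t0) /prob_empty fine_ge0//= rlker1 t0.
by rewrite -lee_fin fineK ?probability_le1// fin_num_measure.
Qed.

Lemma laplace_integrable_empty : laplace_integrable s Ge.
Proof.
apply: bounded_laplace_integrable => //; first exact: measurable_mlseries.
by move=> t; have /andP[g0 g1] := empty_mlseries_bounds t; rewrite ger0_norm.
Qed.

Lemma laplace_integrable_mgf_le0 z : z <= 0 -> laplace_integrable s (Gm z).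
Proof.
move=> z0; apply: bounded_laplace_integrable => //; first exact: measurable_mlseries.
by move=> t; rewrite ger0_norm ?mgf_mlseries_ge0// mgf_mlseries_le_rlker1.
Qed.

Lemma lap_ge0 f : (forall t, 0 <= f t) -> 0 <= lap f.
Proof. by move=> f0; apply: Rintegral_ge0 => t _; rewrite mulr_ge0 ?expR_ge0. Qed.

(** [laplace_combination] for the coefficients of [M z] and [p00], multiplied
    by [e^z]. *)
Lemma kernel_equation z : laplace_integrable s (Gm z) ->
  - (p * (expR z - r1) * (expR z - r2)) * lap (Gm z) =
  expR z * tau + (1 - p) * (expR z - 1) * lap Ge.
Proof.
move=> intz.
have := @laplace_combination _ alpha s alpha0 s0 (mgf_coef Q z) (empty_coef Q)
  (drift p z) (boundary_rate p z) (hm z) he (mgf_mlseries_ge0 z) _ intz laplace_integrable_empty.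
move=> /(_ _ (mgf_coef0 emptyQ z) (mgf_coefS p01 hqueue emptyQ z)) H.
have {}H := H (fun t => proj1 (andP (empty_mlseries_bounds t))).
rewrite -drift_factor// mulrAC H /boundary_rate.
have e0 : expR (- z) * expR z = 1 by rewrite -expRD addNr expR0.
transitivity (expR z * tau + (1 - p) * (expR z - expR (- z) * expR z) * lap Ge); first by ring.
by rewrite e0.
Qed.

(** [kernel_equation] at [e^z = r2], where the left-hand side vanishes; there
    [M z <= 1], so convergence is clear. *)
Lemma laplace_empty : (1 - p) * (1 - r2) * lap Ge = r2 * tau.
Proof.
have [r20 r21 r11] := char_roots_order alpha p01 s0.
have Er : expR (ln r2) = r2 by rewrite lnK.
have lr : ln r2 <= 0 by rewrite ln_le0// ltW.
have := kernel_equation (laplace_integrable_mgf_le0 lr); rewrite Er subrr mulr0 oppr0 mul0r.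
by move=> H; apply/eqP; rewrite -subr_eq0; apply/eqP; rewrite -[RHS]oppr0 H; ring.
Qed.

(** Substituting [laplace_empty] makes the right-hand side of
    [kernel_equation] divisible by [e^z - r2]. *)
Lemma laplace_mgf_cross z : laplace_integrable s (Gm z) -> expR z != r2 ->
  lap (Gm z) * (p * (r1 - expR z) * (1 - r2)) = tau.
Proof.
have [r20 r21 r11] := char_roots_order alpha p01 s0.
move=> intz zr2; have := kernel_equation intz => H.
have zr : expR z - r2 != 0 by rewrite subr_eq0.
apply: (mulfI zr).
transitivity ((1 - r2) * (- (p * (expR z - r1) * (expR z - r2)) * lap (Gm z))); first by ring.
rewrite H.
transitivity ((1 - r2) * (expR z * tau) + (expR z - 1) * ((1 - p) * (1 - r2) * lap Ge)); first by ring.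
by rewrite laplace_empty; ring.
Qed.

(** The transform is nondecreasing in [z] and is given at neighbouring points
    by [laplace_mgf_cross], whose formula is continuous; so it is squeezed. *)
Lemma laplace_mgf_at_r2 z : expR z = r2 ->
  lap (Gm z) * (p * (r1 - expR z) * (1 - r2)) = tau.
Proof.
have [r20 r21 r11] := char_roots_order alpha p01 s0.
have /andP[p0 p1] := p01.
move=> zr2.
have ez e : 0 < r2 + e -> expR (ln (r2 + e)) = r2 + e by move=> h; rewrite lnK.
have z0 : z <= 0 by rewrite -expR_le1 zr2 ltW.
have c0 : 0 < p * (1 - r2) by rewrite mulr_gt0// subr_gt0.
have V0 : 0 <= lap (Gm z) by apply: lap_ge0 => t; exact: mgf_mlseries_ge0.
have mono y y' : y <= y' -> y' <= 0 -> lap (Gm y) <= lap (Gm y').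
  move=> yy' y'0; apply: le_Rintegral => //.
  - exact: laplace_integrable_mgf_le0 (le_trans yy' y'0).
  - exact: laplace_integrable_mgf_le0.
  - by move=> t _; rewrite ler_wpM2l ?expR_ge0// mgf_mlseries_le.
(* The formula at the points whose exponential is [r2 + e], on both sides. *)
have crossE e : 0 < r2 + e -> r2 + e <= 1 -> e != 0 ->
    lap (Gm (ln (r2 + e))) * (r1 - r2 - e) = tau / (p * (1 - r2)).
  move=> e1 e2 e0.
  have := @laplace_mgf_cross (ln (r2 + e)); rewrite ez// => H.
  have /H {}H : laplace_integrable s (Gm (ln (r2 + e))) by apply: laplace_integrable_mgf_le0; rewrite ln_le0.
  have /H {}H : r2 + e != r2 by rewrite -subr_eq0 addrAC subrr add0r.
  apply: (mulIf (lt0r_neq0 c0)); rewrite divfK ?lt0r_neq0// -H; ring.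
have lnle x y : 0 < x -> 0 < y -> x <= y -> ln x <= ln y by move=> x0 y0 xy; rewrite ler_ln.
have zE : z = ln r2 by rewrite -zr2 expRK.
suff E : lap (Gm z) * (r1 - r2) = tau / (p * (1 - r2)).
  rewrite zr2 (_ : p * (r1 - r2) * (1 - r2) = (r1 - r2) * (p * (1 - r2))); last by ring.
  by rewrite mulrA E divfK// lt0r_neq0.
apply/eqP; rewrite eq_le; apply/andP; split.
- apply: (@le_of_lt_shift _ _ _ _ (1 - r2)) => //; first by rewrite subr_gt0.
  move=> e /andP[e0 e1].
  rewrite -(crossE e); [|lra|lra|by rewrite gt_eqF].
  apply: ler_wpM2r; first by lra.
  by apply: mono; [rewrite zE; apply: lnle; lra|rewrite ln_le0//; lra].
- apply: (@ge_of_lt_shift _ _ _ _ r2) => // e /andP[e0 e1].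
  rewrite -(crossE (- e)); [|lra|lra|by rewrite oppr_eq0 gt_eqF].
  rewrite opprK; apply: ler_wpM2r; first by lra.
  by apply: mono; [rewrite zE; apply: lnle; lra|].
Qed.

Lemma laplace_mgf z : laplace_converges (mgf P L z) s ->
  laplace (mgf P L z) s = - tau / (p * (expR z - r1) * (1 - r2)).
Proof.
have [r20 r21 r11] := char_roots_order alpha p01 s0.
have /andP[p0 p1] := p01.
have tau0 : 0 < tau by exact: powR_gt0.
have E t : expR (- s * t) * Gm z t = ((fun t => expR (- s * t) * mgf P L z t) \_ `[0, +oo[) t.
  rewrite patchE; case: ifPn => [|].
    by rewrite inE/= in_itv/= andbT => t0; rewrite (mgfE alpha0 p01 hqueue emptyQ).
  rewrite notin_setE/= in_itv/= andbT => /negP; rewrite -ltNge => t0.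
  by rewrite mlseries_lt0// mulr0.
move=> conv.
have intz : laplace_integrable s (Gm z).
  rewrite /laplace_integrable (_ : (fun t => _) =
    (fun t => expR (- s * t) * mgf P L z t) \_ `[0, +oo[); last exact/funext/E.
  rewrite -restrict_EFin; apply: (proj1 (integrable_mkcond _ _)); last exact: conv.
  exact: measurable_itv.
have -> : laplace (mgf P L z) s = lap (Gm z).
  by rewrite /laplace Rintegral_mkcond /laplaceR; apply: eq_Rintegral => t _; rewrite E.
have K : lap (Gm z) * (p * (r1 - expR z) * (1 - r2)) = tau.
  by have [/laplace_mgf_at_r2//|/(laplace_mgf_cross intz)] := eqVneq (expR z) r2.
have n0 : p * (r1 - expR z) * (1 - r2) != 0.
  by apply/eqP => h; move: K; rewrite h mulr0 => h'; rewrite -h' ltxx in tau0.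
rewrite (_ : p * (expR z - r1) * (1 - r2) = - (p * (r1 - expR z) * (1 - r2))); last by ring.
by rewrite invrN mulrNN -K mulfK.
Qed.
End laplace_mgf.

Theorem theorem3p2 (R : realType) (d : measure_display) (T : measurableType d)
    (P : probability T R) (alpha p : R)
    (X : nat -> {RV P >-> R}) (Q : nat -> {RV P >-> nat})
    (halpha : 0 < alpha <= 1) (hp : 0 < p < 1)
    (hqueue : is_fractional_queue_data alpha 1 p X Q)
    (hempty : started_empty Q) :
  let L : R -> T -> nat := time_changed X Q in
  let p00 : R -> R := prob_empty P L in
  let M : R -> R -> R := mgf P L in
  [/\ (forall z t : R, 0 <= t ->
         P.-integrable setT (fun w => (expR (z * (L t w)%:R))%:E)),
      (forall z t : R, 0 < t ->
         is_caputo_derive alpha (M z) t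
           ((1 - p) * (1 - expR (- z)) * p00 t
            + (p * expR z - 1 + (1 - p) * expR (- z)) * M z t)) &
      (forall z s : R, 0 < s -> laplace_converges (M z) s ->
         laplace (M z) s =
         - s `^ (alpha - 1)
         / (p * (expR z - r1 alpha p s) * (1 - r2 alpha p s)))].
Proof.
have /andP[a0 a1] := halpha.
split=> [z t t0|z t t0|z s s0].
- exact: (integrable_mgf a0 hp hqueue hempty).
- exact: (caputo_mgf a0 hp hqueue hempty).
- exact: (laplace_mgf a0 hp hqueue hempty s0).
Qed.
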